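(* Assume the Continuum Hypothesis fails. Then for every valuation domain $R$ of cardinality $\aleph_1$ and every type $J/R$ such that $\Gamma(J/R)\neq 0$, there is a non-standard uniserial $R$-module of type $J/R$.
   Context: A valuation domain is an integral domain whose ideals are linearly ordered; $Q$ its quotient field. A module is uniserial if its submodules are linearly ordered; a uniserial $R$-module is standard if isomorphic to $J'/A$ for $R$-submodules $A\subseteq J'$ of $Q$, non-standard otherwise. For uniserial $U$ and $0\neq a\in U$, $\mathrm{Ann}(a)=\{r:ra=0\}$, $D(a)=\bigcup\{r^{-1}R:a\in rU\}$; $U$ has type $J/A$ if $J/A\cong D(a)/\mathrm{Ann}(a)$. A type $J/R$ is given by an $R$-submodule $J$ of $Q$ with $R\subseteq J$; write $J=\bigcup_{\sigma<\omega_1} r_\sigma^{-1}R$ with nonzero $r_\sigma\in R$, $r_\tau\mid r_\sigma$ for $\tau<\sigma$. A cub is a closed unbounded subset of $\omega_1$; $D(\omega_1)$ is ${\cal P}(\omega_1)$ modulo $S_1\sim S_2$ iff $S_1\cap C=S_2\cap C$ for some cub $C$, a Boolean algebra whose $0$ is the class of sets disjoint from a cub and whose $1$ is the class of sets containing a cub. $\Gamma(J/R)$ is the class of $S=\{\delta<\omega_1\text{ limit}: R/\bigcap_{\sigma<\delta}r_\sigma R\text{ is not complete}\}$, where $R/\bigcap_{\sigma<\delta}r_\sigma R$ carries the metrizable linear topology with basis of neighbourhoods of $0$ given by the images of $r_\sigma R$, $\sigma<\delta$. This is independent of the choice of the $r_\sigma$. *)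

(* Defs.v *)
From HB Require Import structures.
From mathcomp Require Import all_boot all_order all_algebra fraction.
Set Implicit Arguments. Unset Strict Implicit. Unset Printing Implicit Defensive.
Import Order.TTheory GRing.Theory Num.Theory.
Local Open Scope ring_scope.

Definition countable_type (T : Type) : Prop :=
  exists f : T -> nat, forall x y, f x = f y -> x = y.

Definition is_omega1 (W : Type) (lt : W -> W -> Prop) : Prop :=
  (forall x, ~ lt x x) /\
  (forall x y z, lt x y -> lt y z -> lt x z) /\
  (forall x y, lt x y \/ x = y \/ lt y x) /\
  well_founded lt /\
  ~ countable_type W /\
  (forall w : W, countable_type {x : W | lt x w}).

Definition is_limit (W : Type) (lt : W -> W -> Prop) (d : W) : Prop :=
  (exists x, lt x d) /\ (forall x, lt x d -> exists y, lt x y /\ lt y d).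

Definition is_cub (W : Type) (lt : W -> W -> Prop) (C : W -> Prop) : Prop :=
  (forall x, exists y, lt x y /\ C y) /\
  (forall d, is_limit lt d ->
     (forall x, lt x d -> exists y, [/\ C y, lt x y & lt y d]) -> C d).

(* the class of S in D(omega_1) is nonzero: S is not disjoint from any cub *)
Definition class_nonzero (W : Type) (lt : W -> W -> Prop) (S : W -> Prop) : Prop :=
  forall C, is_cub lt C -> exists d, S d /\ C d.

Definition equipotent (A B : Type) : Prop :=
  exists (f : A -> B) (g : B -> A), cancel f g /\ cancel g f.

(* not CH, relative to omega_1 = W: 2^aleph_0 is not <= aleph_1 *)
Definition not_CH (W : Type) : Prop :=
  ~ exists f : (nat -> bool) -> W, forall x y, f x = f y -> x = y.

Definition is_ideal (R : idomainType) (I : R -> Prop) : Prop :=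
  [/\ I 0, (forall x y, I x -> I y -> I (x + y)) & (forall r x, I x -> I (r * x))].

Definition valuation_domain (R : idomainType) : Prop :=
  forall I K : R -> Prop, is_ideal I -> is_ideal K ->
    (forall x, I x -> K x) \/ (forall x, K x -> I x).

Definition dvd (R : idomainType) (a b : R) : Prop := exists c, b = c * a.

Definition emb (R : idomainType) (x : R) : {fraction R} := @FracField.tofrac R x.

Definition Qsubmod (R : idomainType) (M : {fraction R} -> Prop) : Prop :=
  [/\ M 0, (forall x y, M x -> M y -> M (x + y))
         & (forall (r : R) x, M x -> M (emb r * x))].

Definition Rpart (R : idomainType) : {fraction R} -> Prop :=
  fun x => exists s : R, x = emb s.

(* J/A isomorphic to M/B (all four R-submodules of Q, A <= J, B <= M),
   given by a map phi : J -> M inducing the R-isomorphism J/A -> M/B *)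
Definition subquot_iso (R : idomainType) (J A M B : {fraction R} -> Prop) : Prop :=
  exists phi : {fraction R} -> {fraction R},
  [/\ (forall x, J x -> M (phi x)),
      (forall x y, J x -> J y -> B (phi (x + y) - (phi x + phi y))),
      (forall (r : R) x, J x -> B (phi (emb r * x) - emb r * phi x)),
      (forall y, M y -> exists2 x, J x & B (phi x - y))
    & (forall x, J x -> (B (phi x) <-> A x))].

Definition submod (R : idomainType) (U : lmodType R) (N : U -> Prop) : Prop :=
  [/\ N 0, (forall x y, N x -> N y -> N (x + y)) & (forall (r : R) x, N x -> N (r *: x))].

Definition uniserial (R : idomainType) (U : lmodType R) : Prop :=
  forall N N' : U -> Prop, submod N -> submod N' ->
    (forall x, N x -> N' x) \/ (forall x, N' x -> N x).

(* U is isomorphic to J'/A: a map f : J' -> U inducing an R-isomorphism J'/A -> U *)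
Definition iso_to_subquot (R : idomainType) (U : lmodType R)
    (J' A : {fraction R} -> Prop) : Prop :=
  exists f : {fraction R} -> U,
  [/\ (forall x y, J' x -> J' y -> f (x + y) = f x + f y),
      (forall (r : R) x, J' x -> f (emb r * x) = r *: f x),
      (forall u, exists2 x, J' x & f x = u)
    & (forall x, J' x -> (f x = 0 <-> A x))].

Definition standard (R : idomainType) (U : lmodType R) : Prop :=
  exists J' A : {fraction R} -> Prop,
    [/\ Qsubmod J', Qsubmod A, (forall x, A x -> J' x) & iso_to_subquot U J' A].

Definition Ann (R : idomainType) (U : lmodType R) (a : U) : R -> Prop :=
  fun r => r *: a = 0.

Definition Dset (R : idomainType) (U : lmodType R) (a : U) : {fraction R} -> Prop :=
  fun x => exists r : R, [/\ r != 0, (exists u : U, r *: u = a)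
                            & exists s : R, x = emb s / emb r].

Definition has_type (R : idomainType) (U : lmodType R) (J A : {fraction R} -> Prop) : Prop :=
  exists a : U, a != 0 /\
    subquot_iso J A (Dset a) (fun x => exists2 r, Ann a r & x = emb r).

Definition omega1_chain (W : Type) (lt : W -> W -> Prop) (R : idomainType)
    (r : W -> R) (J : {fraction R} -> Prop) : Prop :=
  [/\ (forall s, r s != 0),
      (forall t s, lt t s -> dvd (r t) (r s))
    & (forall x, J x <-> exists s, exists c : R, x = emb c / emb (r s))].

(* R / (cap_{sigma<delta} r_sigma R) is complete in the linear topology with basis
   of neighbourhoods of 0 the images of r_sigma R (sigma < delta); this topology is
   metrizable for countable delta, so completeness = convergence of Cauchy sequences
   (sequences are taken in R via lifting). *)
Definition complete_at (W : Type) (lt : W -> W -> Prop) (R : idomainType)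
    (r : W -> R) (d : W) : Prop :=
  forall x : nat -> R,
    (forall s, lt s d -> exists N, forall m n, (N <= m)%N -> (N <= n)%N ->
        dvd (r s) (x m - x n)) ->
    exists y : R, forall s, lt s d -> exists N, forall n, (N <= n)%N -> dvd (r s) (x n - y).

Definition Gamma_set (W : Type) (lt : W -> W -> Prop) (R : idomainType)
    (r : W -> R) : W -> Prop :=
  fun d => is_limit lt d /\ ~ complete_at lt r d.

(* Main.v *)
(**
Write [G] for the group of units of [R] that are congruent to [1] modulo a fixed nonunit
[r_s0], and [N_s] for its subgroup of units congruent to [1] modulo [r_s].  Gluing the modules
[R / r_s R] along multiplication by [e_s^t (r_t / r_s)], where [e_s^t] in [G] satisfies
[e_a^t = e_a^s e_s^t] modulo [N_a], gives a uniserial module of type [J/R]; it is standard only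
if [e] is trivial, i.e. if [c_s = e_s^t c_t] modulo [N_s] for some units [c_s].  The hypothesis
on [Gamma] only serves to make the sequence [r_s] non-stationary.

A nontrivial [e] is built by recursion on [t].  If the quotients [N_s / N_t] are not eventually
countable, a limit row [e^d] is chosen such that no translate [u e^d] lies, modulo all the [N_s],
in a countable subgroup [H] containing the first [d] elements of [G] and the earlier values of
[e]: there are continuum many candidates pairwise incongruent modulo [H] and at most [aleph_1]
translates [u], so the failure of CH provides one.  A trivialization would have its first [d]
values in [H] for some limit [d], a contradiction.

If all [G / N_s] are countable, code each of them by natural numbers.  In the manner of a special
Aronszajn tree, limit rows are chosen such that along every translate of [e^d] the codes are
eventually above any given bound (on a cofinal set of levels).  A trivialization would have
codes bounded by some [n] at uncountably many levels, hence cofinally below some limit [d].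
*)

From Pilot Require Import Defs.
From HB Require Import structures.
From mathcomp Require Import all_boot all_order all_algebra fraction generic_quotient.
From mathcomp Require Import boolp ring.
(* Re-imported because [order] shadows [dvd]. *)
Import Pilot.Defs.
Set Implicit Arguments. Unset Strict Implicit. Unset Printing Implicit Defensive.
Import GRing.Theory.
Local Open Scope ring_scope.

Lemma surj_countable (K : countType) (T : Type) (D : K -> T) :
  (forall x, exists k, D k = x) -> countable_type T.
Proof.
move=> /choice[c cK]; exists (fun x => pickle (c x)) => x y.
by move=> /(pcan_inj pickleK) cxy; rewrite -(cK x) cxy.
Qed.

(** * Countable limits in omega_1 *)

Section Omega1.
Variables (W : Type) (lt : W -> W -> Prop).
Hypothesis HW : is_omega1 lt.

Lemma lt_irr x : ~ lt x x.
Proof. by case: HW. Qed.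

Lemma lt_trans x y z : lt x y -> lt y z -> lt x z.
Proof. by case: HW => _ [+ _]; apply. Qed.

Lemma lt_tri x y : [\/ lt x y, x = y | lt y x].
Proof.
case: HW => _ [_ [+ _]] => /(_ x y)[|[|]] ?; first exact: Or31.
- exact: Or32.
- exact: Or33.
Qed.

Lemma lt_wf : well_founded lt.
Proof. by case: HW => _ [_ [_ [+ _]]]. Qed.

Definition le x y := x = y \/ lt x y.

Lemma le_lt_trans x y z : le x y -> lt y z -> lt x z.
Proof. by case=> [->//|]; apply: lt_trans. Qed.

Lemma lt_le_trans x y z : lt x y -> le y z -> lt x z.
Proof. by move=> xy [<-//|]; apply: lt_trans. Qed.

Lemma le_total x y : le x y \/ le y x.
Proof. by case: (lt_tri x y); [left; right|left; left|right; right]. Qed.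

Lemma nlt_le x y : ~ lt x y -> le y x.
Proof. by case: (lt_tri x y) => [+ h|->|?] => [/h|_|_] //; [left|right]. Qed.

Lemma lt_nle x y : lt x y -> ~ le y x.
Proof. by move=> xy yx; apply: (lt_irr (lt_le_trans xy yx)). Qed.

Lemma initial_enum d :
  exists g : nat -> W, forall x, lt x d -> exists n, g n = x.
Proof.
case: HW => _ [_ [_ [_ [_ /(_ d)[c cinj]]]]].
pose P n (w : W) := forall x (xd : lt x d), c (exist _ x xd) = n -> w = x.
have /choice[g gP] : forall n, exists w, P n w.
  move=> n; case: (pselect (exists x (xd : lt x d), c (exist _ x xd) = n)).
    move=> [x [xd cx]]; exists x => y yd cy.
    by have /cinj[] : c (exist _ x xd) = c (exist _ y yd) by rewrite cx cy.
  by move=> nex; exists d => x xd cx; case: nex; exists x, xd.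
by exists g => x xd; exists (c (exist _ x xd)); apply: gP.
Qed.

(** Otherwise the countably many segments up to the [g n], each countable, would cover [W]. *)
Lemma seq_bound (g : nat -> W) : exists b, forall n, lt (g n) b.
Proof.
apply: contrapT => nb.
have cover b : exists n, le b (g n).
  apply: contrapT => nn; apply: nb; exists b => n.
  by apply: contrapT => /nlt_le ?; apply: nn; exists n.
case: HW => _ [_ [_ [_ [+ _]]]]; apply.
have /choice[G GP] n := initial_enum (g n).
pose D (p : nat * option nat) := if p.2 is Some k then G p.1 k else g p.1.
apply: (@surj_countable _ _ D) => x; case: (cover x) => n [->|/GP[k]].
  by exists (n, None).
by exists (n, Some k).
Qed.

Lemma ub2 x y : exists z, lt x z /\ lt y z.
Proof.
case: (seq_bound (fun n => if n is 0%N then x else y)) => z zP.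
by exists z; split; [apply: (zP 0%N)|apply: (zP 1%N)].
Qed.

Lemma minimal_elt (P : W -> Prop) :
  (exists x, P x) -> exists x, P x /\ forall y, lt y x -> ~ P y.
Proof.
case=> x; elim: (lt_wf x) => {}x _ IH Px.
case: (pselect (exists y, lt y x /\ P y)) => [[y [yx Py]]|nex]; first exact: IH Py.
by exists x; split=> // y yx Py; apply: nex; exists y.
Qed.

Definition increasing (s : nat -> W) := forall n, lt (s n) (s n.+1).

Definition cofinal_in (s : nat -> W) (d : W) :=
  [/\ increasing s, forall n, lt (s n) d & forall x, lt x d -> exists n, lt x (s n)].

Lemma increasing_lt s m n : increasing s -> (m < n)%N -> lt (s m) (s n).
Proof.
move=> sI; elim: n => // n IH; rewrite ltnS leq_eqVlt => /predU1P[->|/IH ?] //.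
exact: lt_trans (sI n).
Qed.

Lemma increasing_le s m n : increasing s -> (m <= n)%N -> le (s m) (s n).
Proof.
move=> sI; rewrite leq_eqVlt => /predU1P[->|]; first by left.
by move=> /(increasing_lt sI); right.
Qed.

Lemma increasing_limit s :
  increasing s -> exists d, is_limit lt d /\ cofinal_in s d.
Proof.
move=> sI; case: (minimal_elt (seq_bound s)) => d [dP dmin].
have cof x : lt x d -> exists n, lt x (s n).
  move=> xd; apply: contrapT => nn; apply: (dmin _ xd) => n.
  have /nlt_le[E|//] : ~ lt x (s n) by move=> ?; apply: nn; exists n.
  by case: nn; exists n.+1; rewrite -E.
exists d; split=> //; split; first by exists (s 0%N).
by move=> x /cof[n xn]; exists (s n).
Qed.

(** The closing-off argument: it supplies the limit levels at which a supposed trivialization is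
    refuted. *)
Lemma iterate_limit (b : W) (Q : W -> W -> Prop) :
  (forall x, exists y, lt x y /\ Q x y) ->
  exists s d, [/\ is_limit lt d, cofinal_in s d, lt b d & forall n, Q (s n) (s n.+1)].
Proof.
move=> /choice[f fP]; pose s n := iter n f b.
have sI : increasing s by move=> n; case: (fP (s n)).
case: (increasing_limit sI) => d [dl sd]; exists s, d; split=> //.
  by case: sd => _ /(_ 0%N).
by move=> n; case: (fP (s n)).
Qed.

Lemma limit_enum d : is_limit lt d ->
  exists g : nat -> W, (forall n, lt (g n) d) /\ forall x, lt x d -> exists n, g n = x.
Proof.
move=> [[x0 x0d] _]; case: (initial_enum d) => g gP.
exists (fun n => if `[< lt (g n) d >] then g n else x0); split=> [n|x xd].
  by case: asboolP.
by case: (gP _ xd) => n gn; exists n; rewrite gn; case: asboolP.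
Qed.

Lemma limit_seq d (Q : W -> W -> Prop) (g : nat -> W) : is_limit lt d ->
  (forall n, lt (g n) d) ->
  (forall x, lt x d -> exists y, [/\ lt x y, lt y d & Q x y]) ->
  (forall x y z, Q x y -> lt y z -> Q x z) ->
  exists s, [/\ increasing s, forall n, lt (s n) d, forall n, lt (g n) (s n)
              & forall n, Q (s n) (s n.+1)].
Proof.
move=> dl gd Qex Qmon.
have step (x w : W) : exists z, lt x d -> lt w d -> [/\ lt x z, lt w z, lt z d & Q x z].
  case: (pselect (lt x d /\ lt w d)) => [[xd wd]|nd]; last first.
    by exists x => xd wd; case: nd.
  case: (Qex _ xd) => y [xy yd qxy].
  have [m [ym wm md]] : exists m, [/\ le y m, le w m & lt m d].
    case: (le_total y w) => h; [exists w|exists y]; split=> //; by left.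
  case: dl => _ /(_ _ md)[z [mz zd]]; exists z => _ _.
  have yz := le_lt_trans ym mz; split=> //.
  - exact: lt_trans xy yz.
  - exact: le_lt_trans wm mz.
  - exact: Qmon qxy yz.
have /choice[f fP] : forall p : W * W, exists z, lt p.1 d -> lt p.2 d ->
  [/\ lt p.1 z, lt p.2 z, lt z d & Q p.1 z] by case=> x w; apply: step.
pose s := fix s n := if n is n'.+1 then f (s n', g n) else f (g 0%N, g 0%N).
have sd n : lt (s n) d.
  elim: n => [|n IH] /=; first by case: (fP (g 0%N, g 0%N) (gd _) (gd _)).
  by case: (fP (s n, g n.+1) IH (gd _)).
have sS n : [/\ lt (s n) (s n.+1), lt (g n.+1) (s n.+1), lt (s n.+1) d & Q (s n) (s n.+1)].
  exact: (fP (s n, g n.+1) (sd n) (gd _)).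
exists s; split=> // [n|n|n]; try by case: (sS n).
case: n => [|n]; last by case: (sS n).
by case: (fP (g 0%N, g 0%N) (gd _) (gd _)).
Qed.

Lemma limit_cofinal_seq d (Q : W -> W -> Prop) : is_limit lt d ->
  (forall x, lt x d -> exists y, [/\ lt x y, lt y d & Q x y]) ->
  (forall x y z, Q x y -> lt y z -> Q x z) ->
  exists s, cofinal_in s d /\ forall n, Q (s n) (s n.+1).
Proof.
move=> dl Qex Qmon; case: (limit_enum dl) => g [gd gP].
case: (limit_seq dl gd Qex Qmon) => s [sI sd gs sQ].
by exists s; split=> //; split=> // x /gP[n <-]; exists n.
Qed.

Lemma zero_succ_limit d :
  [\/ forall x, ~ lt x d,
      exists g, lt g d /\ forall x, lt x d -> le x g | is_limit lt d].
Proof.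
case: (pselect (exists x, lt x d)) => [ex|nex]; last first.
  by apply: Or31 => x xd; apply: nex; exists x.
case: (pselect (forall x, lt x d -> exists y, lt x y /\ lt y d)) => [h|].
  exact: Or33.
move=> /existsNP[g /not_implyP[gd ng]]; apply: Or32; exists g; split=> // x xd.
by apply: nlt_le => gx; apply: ng; exists x.
Qed.

(* [P d e] is meant to constrain the row [e d] given the rows below it. *)
Lemma transfinite_rows (A : Type) (a0 : A) (P : W -> (W -> A) -> Prop) :
  (forall d e e', (forall t, le t d -> e t = e' t) -> P d e -> P d e') ->
  (forall d e, (forall t, lt t d -> P t e) ->
     exists x, P d (fun t => if `[< t = d >] then x else e t)) ->
  exists e, forall d, P d e.
Proof.
move=> Ploc Pext.
(* The recursion knows only the rows below [d]; [ext] puts [x] at all other levels, and [Ploc] makes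
   the choice above [d] harmless. *)
pose ext d (e : forall t, lt t d -> A) (x : A) t :=
  if pselect (lt t d) is left td then e t td else x.
have /choice[F FP] : forall p : {d : W & forall t, lt t d -> A}, exists x : A,
    (exists x', P (projT1 p) (ext _ (projT2 p) x')) -> P (projT1 p) (ext _ (projT2 p) x).
  move=> p; case: (pselect (exists x', P (projT1 p) (ext _ (projT2 p) x'))).
    by case=> x Px; exists x.
  by exists a0.
pose e := Fix lt_wf (fun _ => A) (fun d rec => F (existT _ d rec)).
have eE d : e d = F (existT _ d (fun t _ => e t)).
  rewrite /e Fix_eq // => x f g fg; congr (F (existT _ x _)).
  by apply: functional_extensionality_dep => y; apply: functional_extensionality_dep.
exists e => d; elim: (lt_wf d) => {}d _ IH.
have [x Px] := Pext d e IH.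
have := FP (existT _ d (fun t _ => e t)) => /=; rewrite -eE => FPd.
suff : P d (ext d (fun t _ => e t) (e d)).
  apply: Ploc => t [->|td]; rewrite /ext; case: pselect => //.
apply: FPd; exists x; apply: Ploc Px => t [->|td].
  by rewrite /ext; case: pselect => [/lt_irr|_] //; case: asboolP.
by rewrite /ext; case: pselect => // _; case: asboolP => // tE; move: td; rewrite tE => /lt_irr.
Qed.

End Omega1.

(** * Identities in abelian groups, by reflection *)

Inductive zexp := ZZero | ZVar of nat | ZAdd of zexp & zexp | ZOpp of zexp.

Fixpoint zeval (G : zmodType) (l : seq G) (e : zexp) : G :=
  match e with
  | ZZero => 0
  | ZVar i => l`_i
  | ZAdd a b => zeval l a + zeval l b
  | ZOpp a => - zeval l a
  end.

Fixpoint zcoef (e : zexp) (i : nat) : int :=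
  match e with
  | ZZero => 0
  | ZVar j => (i == j)%:Z
  | ZAdd a b => zcoef a i + zcoef b i
  | ZOpp a => - zcoef a i
  end.

Lemma zevalE (G : zmodType) (l : seq G) e :
  zeval l e = \sum_(i < size l) l`_i *~ zcoef e i.
Proof.
elim: e => [|j|a IHa b IHb|a IHa] /=.
- by rewrite big1.
- case: (ltnP j (size l)) => jl.
    rewrite (bigD1 (Ordinal jl)) //= eqxx big1 ?addr0 // => i /negPf ij.
    by case: eqP => // E; move: ij; rewrite -val_eqE /= E eqxx.
  rewrite nth_default // big1 // => i _; case: eqP => // E.
  by move: jl; rewrite -E leqNgt ltn_ord.
- by rewrite IHa IHb -big_split; apply: eq_bigr => i _; rewrite mulrzDr.
- by rewrite IHa -sumrN; apply: eq_bigr => i _; rewrite mulrNz.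
Qed.

(** The comparison of coefficients computes, so [zmod_eq] can discharge it by [isT]. *)
Lemma zeval_eq (G : zmodType) (l : seq G) e1 e2 :
  all (fun i => zcoef e1 i == zcoef e2 i) (iota 0 (size l)) -> zeval l e1 = zeval l e2.
Proof.
move=> /allP h; rewrite !zevalE; apply: eq_bigr => i _; congr (_ *~ _).
by apply/eqP/h; rewrite mem_iota /= ltn_ord.
Qed.

Ltac zfind x l :=
  match l with
  | x :: _ => constr:(0%N)
  | _ :: ?l' => let n := zfind x l' in constr:(n.+1)
  end.
Ltac zinsert x l :=
  match l with
  | context [x :: _] => l
  | _ => constr:(x :: l)
  end.
Ltac zvars t l :=
  match t with
  | 0 => l
  | ?a + ?b => let l' := zvars a l in zvars b l'
  | - ?a => zvars a l
  | _ => zinsert t l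
  end.
Ltac zreify t l :=
  match t with
  | 0 => constr:(ZZero)
  | ?a + ?b => let a' := zreify a l in let b' := zreify b l in constr:(ZAdd a' b')
  | - ?a => let a' := zreify a l in constr:(ZOpp a')
  | _ => let i := zfind t l in constr:(ZVar i)
  end.
Ltac zmod_eq :=
  match goal with |- @eq ?T ?a ?b =>
    let l0 := constr:(@nil T) in
    let l1 := zvars a l0 in let l := zvars b l1 in
    let ea := zreify a l in let eb := zreify b l in
    exact: (@zeval_eq _ l ea eb isT)
  end.

(** * Cocycles in a group filtered by a decreasing chain of subgroups *)

Section Cocycles.
Variables (W : Type) (lt : W -> W -> Prop).
Hypothesis HW : is_omega1 lt.
Variables (G : zmodType) (N : W -> G -> Prop).
Hypothesis N0 : forall s, N s 0.
Hypothesis NB : forall s x y, N s x -> N s y -> N s (x - y).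
Hypothesis Nlt : forall s t x, lt s t -> N t x -> N s x.

Local Notation le := (le lt).

Lemma NN s x : N s x -> N s (- x).
Proof. by move=> h; rewrite -[- x]add0r; apply: NB. Qed.

Lemma ND s x y : N s x -> N s y -> N s (x + y).
Proof. by move=> hx hy; rewrite -[y]opprK; apply: NB => //; apply: NN. Qed.

Lemma Neq s x y : N s y -> x = y -> N s x.
Proof. by move=> + ->. Qed.

Lemma Nle s t x : le s t -> N t x -> N s x.
Proof. by case=> [->//|]; apply: Nlt. Qed.

Definition upd (A : Type) (e : W -> A) (d : W) (x : A) : W -> A :=
  fun t => if `[< t = d >] then x else e t.

Lemma upd_same A (e : W -> A) d x : upd e d x d = x.
Proof. by rewrite /upd; case: asboolP. Qed.

Lemma upd_lt A (e : W -> A) d x t : lt t d -> upd e d x t = e t.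
Proof. by rewrite /upd; case: asboolP => // -> /(lt_irr HW). Qed.

(* [e d s], for [s < d], is the transition element from level [d] down to level [s]. *)
Definition cocycle_at (e : W -> W -> G) (d : W) :=
  e d d = 0 /\ forall a s, lt a s -> lt s d -> N a (e d a - (e s a + e d s)).

(** The coboundary condition: [e t s] is [c s - c t] modulo [N s]. *)
Definition trivializes (e : W -> W -> G) (c : W -> G) :=
  forall s t, lt s t -> N s (c s - (e t s + c t)).

Lemma cocycle_at_local e e' d :
  (forall t, le t d -> e t = e' t) -> cocycle_at e d -> cocycle_at e' d.
Proof.
move=> ee' [h1 h2]; rewrite /cocycle_at -(ee' d); last by left.
by split=> // a s as_ sd; rewrite -(ee' s); [apply: h2|right].
Qed.

Lemma cocycle_atP e d a s : cocycle_at e d -> (forall t, lt t d -> cocycle_at e t) ->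
  le a s -> le s d -> N a (e d a - (e s a + e d s)).
Proof.
move=> [d1 d2] cd as_ [->|sd].
  by rewrite d1; apply: (Neq (N0 _)); zmod_eq.
case: as_ => [->|as_]; last exact: d2.
by case: (cd _ sd) => -> _; apply: (Neq (N0 _)); zmod_eq.
Qed.

(** The new row copies that of the predecessor [g]; as [e g g] is 0, so is the transition from [d]
    to [g]. *)
Lemma cocycle_at_succ e g d : (forall t, lt t d -> cocycle_at e t) -> lt g d ->
  (forall x, lt x d -> le x g) ->
  exists x : W -> G, [/\ x d = 0, cocycle_at (upd e d x) d & forall s, le s g -> x s = e g s].
Proof.
move=> cd gd gmax; exists (upd (e g) d 0).
have xd : upd (e g) d 0 d = 0 by rewrite upd_same.
have xg s : le s g -> upd (e g) d 0 s = e g s.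
  by move=> sg; rewrite upd_lt //; apply: (le_lt_trans HW) sg gd.
split=> //; split; first by rewrite upd_same.
move=> a s as_ sd; rewrite upd_same (@upd_lt _ e d) //.
have sg := gmax _ sd; have ag : le a g by right; apply: (lt_le_trans HW) as_ sg.
rewrite (xg _ sg) (xg _ ag); apply: cocycle_atP => //; first exact: cd.
- by move=> t tg; apply: cd; apply: (lt_trans HW) tg gd.
- by right.
Qed.

Lemma cocycle_at_zero e d : (forall x, ~ lt x d) -> cocycle_at (upd e d (fun=> 0)) d.
Proof. by move=> d0; split; rewrite ?upd_same // => a s _ /d0. Qed.

(** Transitions [t n] from [d] to a cofinal sequence determine a limit row: the values
    [e (s n) a + t n], for [a] up to [s n], agree modulo [N a]. *)
Lemma cocycle_glue e s (t : nat -> G) d : (forall t, lt t d -> cocycle_at e t) ->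
  cofinal_in lt s d ->
  (forall n, N (s n) (t n - (e (s n.+1) (s n) + t n.+1))) ->
  exists x : W -> G, [/\ x d = 0, cocycle_at (upd e d x) d &
    forall n a, le a (s n) -> N a (x a - (e (s n) a + t n))].
Proof.
move=> cd [sI sd scof] tP.
have csd n r : lt r (s n) -> cocycle_at e r.
  by move=> rs; apply: cd; apply: (lt_trans HW) rs (sd n).
have stable m n a : (m <= n)%N -> le a (s m) ->
    N a (e (s m) a + t m - (e (s n) a + t n)).
  move=> + asm; elim: n => [|n IH].
    by rewrite leqn0 => /eqP ->; apply: (Neq (N0 _)); zmod_eq.
  rewrite leq_eqVlt => /predU1P[->|]; first by apply: (Neq (N0 _)); zmod_eq.
  rewrite ltnS => mn; have asn : le a (s n).
    case: asm => [->|asm]; first exact: increasing_le.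
    by right; apply: (lt_le_trans HW) asm (increasing_le HW sI mn).
  have h1 := IH mn; have h2 := Nle asn (tP n).
  have h3 : N a (e (s n.+1) a - (e (s n) a + e (s n.+1) (s n))).
    by apply: cocycle_atP => //; [apply: cd|apply: csd|right].
  by apply: (Neq (ND (ND h1 h2) (NN h3))); zmod_eq.
have /choice[k kP] : forall a, exists n, lt a d -> lt a (s n).
  move=> a; case: (pselect (lt a d)) => [/scof[n an]|]; first by exists n.
  by exists 0%N.
pose x a := if `[< a = d >] then 0 else e (s (k a)) a + t (k a).
have xd : x d = 0 by rewrite /x; case: asboolP.
have xP n a : le a (s n) -> N a (x a - (e (s n) a + t n)).
  move=> an; have ad := le_lt_trans HW an (sd n).
  rewrite /x; case: asboolP => [E|_]; first by move: ad; rewrite E => /(lt_irr HW).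
  case: (leqP (k a) n) => kn; first by apply: stable => //; right; apply: kP.
  by apply: (Neq (NN (stable n (k a) a (ltnW kn) an))); zmod_eq.
exists x; split=> //; split; first by rewrite upd_same.
move=> a b ab bd; rewrite upd_same upd_lt //; case: (scof _ bd) => n bn.
have an := lt_trans HW ab bn.
have h1 := xP n a (or_intror an); have h2 := Nlt ab (xP n b (or_intror bn)).
have h3 : N a (e (s n) a - (e b a + e (s n) b)).
  by apply: cocycle_atP; [apply: cd|apply: csd|right|right].
by apply: (Neq (ND (NB h1 h2) h3)); zmod_eq.
Qed.

End Cocycles.

(** * The uncountable case: avoiding a countable subgroup *)

(** [L] consists of words in signed generators; appending a word with its signs flipped gives
    differences. *)
Lemma countable_subgroup (G : zmodType) (K : countType) (g : K -> G) :
  exists (L : countType) (E : L -> G),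
    (forall k, exists l, E l = g k) /\ (forall l l', exists l'', E l'' = E l - E l').
Proof.
pose f (p : bool * K) := if p.1 then g p.2 else - g p.2.
exists (seq (bool * K)), (fun l => \sum_(p <- l) f p); split=> [k|l l'].
  by exists [:: (true, k)]; rewrite big_seq1.
exists (l ++ [seq (~~ p.1, p.2) | p <- l']); rewrite big_cat big_map /= -sumrN.
by congr (_ + _); apply: eq_bigr => -[[] k] _; rewrite /f /= ?opprK.
Qed.

Section Uncountable.
Variables (W : Type) (lt : W -> W -> Prop).
Hypothesis HW : is_omega1 lt.
Variables (G : zmodType) (N : W -> G -> Prop).
Hypothesis N0 : forall s, N s 0.
Hypothesis NB : forall s x y, N s x -> N s y -> N s (x - y).
Hypothesis Nlt : forall s t x, lt s t -> N t x -> N s x.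

Let NN := NN N0 NB.

Definition countable_mod (s t : W) :=
  exists h : G -> nat, forall x y, N s x -> N s y -> h x = h y -> N t (x - y).

(** If each element of [N s] were congruent to a value of [E], the index of that value would be a
    code. *)
Lemma uncountable_avoid s t (L : countType) (E : L -> G) :
  ~ countable_mod s t ->
  exists k, N s k /\ forall l, ~ N t (k - E l).
Proof.
move=> nc; apply: contrapT => nk; apply: nc.
have [l0 _] : exists l : L, True.
  by apply: contrapT => nl; apply: nk; exists 0; split=> // l; case: nl; exists l.
have /choice[c cP] : forall x, exists l, N s x -> N t (x - E l).
  move=> x; case: (pselect (N s x)) => [sx|]; last by exists l0.
  apply: contrapT => nx; apply: nk; exists x; split=> // l xl.
  by apply: nx; exists l.
exists (fun x => pickle (c x)) => x y sx sy /(pcan_inj pickleK) cxy.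
apply: (Neq (NB (cP _ sx) (cP _ sy))); rewrite cxy; zmod_eq.
Qed.

Variable iota : G -> W.
Hypothesis iota_inj : injective iota.
Hypothesis nCH : not_CH W.

(** At each [n] a branch may add some [k n] in [N (s n)] that is congruent to no value of [E] modulo
    [N (s n.+1)]. If two branches had a common bad translate [u], then at their first difference
    [k n] would be congruent to a value of [E]. So if every branch had a bad [u], choosing one would
    inject the branches into [W]. *)
Lemma avoiding_branch e s d (L : countType) (E : L -> G) :
  (forall t, lt t d -> cocycle_at lt N e t) -> cofinal_in lt s d ->
  (forall l l', exists l'', E l'' = E l - E l') ->
  (forall n, ~ countable_mod (s n) (s n.+1)) ->
  exists t : nat -> G,
    (forall n, N (s n) (t n - (e (s n.+1) (s n) + t n.+1))) /\
    forall u, ~ forall n, exists l, N (s n) (t n + u - E l).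
Proof.
move=> cd sd EB nc.
have /choice[k kP] n := uncountable_avoid E (nc n).
pose t (eta : nat -> bool) := fix t n := if n is n'.+1
  then t n' - e (s n) (s n') + (if eta n' then k n' else 0) else 0.
have tS eta n : t eta n.+1 = t eta n - e (s n.+1) (s n) + (if eta n then k n else 0) by [].
apply: contrapT => nt; apply: nCH.
have /choice[u uP] : forall eta, exists u, forall n, exists l, N (s n) (t eta n + u - E l).
  move=> eta; apply: contrapT => nu; apply: nt; exists (t eta); split=> [n|u h].
    rewrite tS; case: (eta n); [case: (kP n) => kn _|have kn := N0 (s n)].
      by apply: (Neq (NN kn)); zmod_eq.
    by apply: (Neq kn); zmod_eq.
  by apply: nu; exists u.
exists (iota \o u) => eta eta' /iota_inj uE; apply: funext => n.
elim/ltn_ind: n => n IH.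
have tE m : (m <= n)%N -> t eta m = t eta' m.
  by elim: m => // m IHm mn; rewrite !tS IHm ?(ltnW mn) // (IH _ mn).
have [l hl] := uP eta n.+1; have [l' hl'] := uP eta' n.+1.
have [m lm] := EB l l'; have [m' lm'] := EB l' l; case: (kP n) => _ kn.
move: hl hl'; rewrite !tS uE tE //.
case: (eta n) (eta' n) => -[] // hl hl'.
- case: (kn m); apply: (Neq (NB hl hl')); rewrite lm; zmod_eq.
- case: (kn m'); apply: (Neq (NB hl' hl)); rewrite lm'; zmod_eq.
Qed.

Let step d s t := [/\ lt s t, lt t d & ~ countable_mod s t].

(** Here [u] stands for the value at [d] of a possible trivialization, and [H] for a group that
    captures its earlier values. *)
Let good d (e : W -> W -> G) :=
  is_limit lt d -> (forall s, lt s d -> exists t, step d s t) ->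
  exists H : G -> Prop, [/\ forall x y, H x -> H y -> H (x - y),
    forall x, lt (iota x) d -> H x,
    forall s t, lt s t -> lt t d -> H (e t s) &
    forall u, ~ forall s, lt s d -> exists a, H a /\ N s (e d s + u - a)].

Lemma uncountable_step d e :
  (forall t, lt t d -> cocycle_at lt N e t) ->
  exists x, cocycle_at lt N (upd e d x) d /\ good d (upd e d x).
Proof.
move=> cd; case: (zero_succ_limit HW d) => [d0|[g [gd gmax]]|dl].
- exists (fun=> 0); split; first exact: cocycle_at_zero.
  by case=> -[x /d0].
- case: (cocycle_at_succ HW N0 cd gd gmax) => x [_ xc _]; exists x; split=> //.
  case=> _ /(_ _ gd)[y [gy /gmax yg]].
  by case: (lt_nle HW gy yg).
case: (pselect (forall s, lt s d -> exists t, step d s t)) => [unc|nunc]; last first.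
  (* In this case [good] holds vacuously and any glued row will do. *)
  have [s [sd _]] : exists s, cofinal_in lt s d /\ forall n : nat, True.
    apply: (@limit_cofinal_seq _ _ HW d (fun _ _ => True)) => // x xd.
    by case: dl => _ /(_ _ xd)[y []]; exists y.
  pose t := fix t n := if n is n'.+1 then t n' - e (s n) (s n') else 0.
  have tP n : N (s n) (t n - (e (s n.+1) (s n) + t n.+1)).
    by apply: (Neq (N0 _)) => /=; zmod_eq.
  case: (cocycle_glue HW N0 NB Nlt cd sd tP) => x [_ xc _].
  by exists x; split.
case: (@limit_cofinal_seq _ _ HW d (fun x y => ~ countable_mod x y) dl) => //.
  move=> x y z nc yz [h hP]; apply: nc; exists h => a b ax bx ab.
  exact/(Nlt yz)/hP.
move=> s [sd snc]; have [g gP] := initial_enum HW d.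
have /choice[gi giP] : forall n, exists x, forall y, iota y = g n -> x = y.
  move=> n; case: (pselect (exists y, iota y = g n)) => [[y yn]|nn].
    by exists y => z; rewrite -yn => /iota_inj.
  by exists 0 => y yn; case: nn; exists y.
(* Generators of [H]: the group elements numbered below [d] and the earlier values of [e]. *)
pose gam (k : nat + nat * nat) :=
  match k with inl n => gi n | inr p => e (g p.1) (g p.2) end.
case: (countable_subgroup gam) => L [E [Eg EB]].
have [t [tP tu]] := avoiding_branch cd sd EB snc.
case: (cocycle_glue HW N0 NB Nlt cd sd tP) => x [_ xc xt].
exists x; split=> // _ _; exists (fun a => exists l, E l = a).
case: sd => sI sd scof; split.
- by move=> _ _ [l <-] [l' <-]; apply: EB.
- move=> y /gP[n gn]; case: (Eg (inl n)) => l lE; exists l.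
  by rewrite lE /=; apply: giP.
- move=> a b ab bd; rewrite (upd_lt HW) //.
  case: (gP _ bd) => n gn; case: (gP _ (lt_trans HW ab bd)) => m gm.
  by case: (Eg (inr (n, m))) => l lE; exists l; rewrite lE /= gn gm.
- move=> u hu; apply: (tu u) => n; case: (hu _ (sd n)) => _ [[l <-]].
  rewrite upd_same => h; exists l; have h' := xt n (s n) (or_introl erefl).
  have [e0 _] := cd _ (sd n); move: h'; rewrite e0 => h'.
  by apply: (Neq (NB h h')); zmod_eq.
Qed.

Lemma uncountable_nontrivial : (forall s, exists t, lt s t /\ ~ countable_mod s t) ->
  exists e, (forall d, cocycle_at lt N e d) /\ forall c, ~ trivializes lt N e c.
Proof.
move=> unc.
case: (@transfinite_rows _ _ HW _ (fun=> 0)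
         (fun d e => cocycle_at lt N e d /\ good d e)) => [d e e' ee' [ce ge]|d e IH|e eP].
- split; first exact: cocycle_at_local ce.
  move=> dl dunc; case: (ge dl dunc) => H [H1 H2 H3 H4]; exists H; split=> //.
    by move=> s t st td; rewrite -ee'; [apply: H3|right].
  by move=> u; rewrite -ee'; [apply: H4|left].
- by apply: uncountable_step => t /IH[].
exists e; split=> [d|c cP]; first by case: (eP d).
have [b0 _] : exists b : W, True by exists (iota 0).
(* Each [c (s n)] gets a number below [s n.+1], so all of them lie in the group [H] of the limit
   [d]. *)
case: (@iterate_limit _ _ HW b0 (fun x y => lt (iota (c x)) y /\ ~ countable_mod x y)).
  move=> x; case: (unc x) => y [xy nc].
  case: (ub2 HW y (iota (c x))) => z [yz cz]; exists z; split; first exact: (lt_trans HW) xy yz.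
  split=> // -[h hP]; apply: nc; exists h => p q px qx pq; exact/(Nlt yz)/hP.
move=> s [d [dl [sI sd scof] _ sQ]].
case: (eP d) => cd /(_ dl)[].
  move=> x /scof[n xn]; exists (s n.+1); split=> //.
    exact: (lt_trans HW) xn (sI n).
  case: (sQ n) => _ nc [h hP]; apply: nc; exists h => p q pn qn.
  by apply: hP; apply: Nlt xn _.
move=> H [H1 H2 H3 H4]; apply: (H4 (c d)) => x /scof[n xn].
have Hc : H (c (s n)).
  by apply: H2; case: (sQ n) => h _; apply: (lt_trans HW) h (sd _).
(* This is [e (s n) x + c (s n)], written by means of the differences under which [H] is closed. *)
exists (e (s n) x - (c (s n) - c (s n) - c (s n))); split.
  by do !apply: (H1) => //; apply: H3.
have h1 : N x (e d x - (e (s n) x + e d (s n))) by case: cd => _; apply.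
have h2 := Nlt xn (cP _ _ (sd n)).
by apply: (Neq (NB h1 h2)); zmod_eq.
Qed.

End Uncountable.

(** * The countable case: escaping codes, as in a special Aronszajn tree *)

Section Countable.
Variables (W : Type) (lt : W -> W -> Prop).
Hypothesis HW : is_omega1 lt.
Variables (G : zmodType) (N : W -> G -> Prop).
Hypothesis N0 : forall s, N s 0.
Hypothesis NB : forall s x y, N s x -> N s y -> N s (x - y).
Hypothesis Nlt : forall s t x, lt s t -> N t x -> N s x.
Variable h : W -> G -> nat.
Hypothesis hP : forall s x y, h s x = h s y <-> N s (x - y).

Local Notation le := (le lt).
Let NN := NN N0 NB.
Let ND := ND N0 NB.
Let Nle := Nle Nlt.

Let h_congr s x y : N s (x - y) -> h s x = h s y.
Proof. by move/hP. Qed.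

Definition shrinks s t := exists x, N s x /\ ~ N t x.

(** At these levels each earlier [N s] still has infinitely many cosets, which leaves room for large
    codes. *)
Definition stage d :=
  is_limit lt d /\ forall s, lt s d -> exists t, [/\ lt s t, lt t d & shrinks s t].

Let shrinks_mon x y z : shrinks x y -> lt y z -> shrinks x z.
Proof. by move=> [a [ax ay]] yz; exists a; split=> // az; apply/ay/(Nlt yz). Qed.

(** Along an increasing sequence [c], take [w j] in [N (c j)] but not in [N (c j.+1)]; later terms
    lie in [N (c i.+1)] and cannot cancel [w i]. *)
Lemma stage_incongruent d s : stage d -> lt s d ->
  exists w : nat -> G, (forall j, N s (w j)) /\ forall i j, (i < j)%N -> ~ N d (w i - w j).
Proof.
move=> [dl dS] sd.
case: (@limit_seq _ _ HW d shrinks (fun=> s) dl (fun=> sd) dS shrinks_mon) => c [cI cd sc cQ].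
have /choice[w wP] n : exists x, N (c n) x /\ ~ N (c n.+1) x := cQ n.
exists w; split=> [j|i j ij]; first by apply: Nlt (sc j) _; case: (wP j).
move=> dij; case: (wP i) => _; apply; case: (wP j) => wj _.
have h1 := Nle (increasing_le HW cI ij) wj; have h2 := Nlt (cd i.+1) dij.
by apply: (Neq (ND h1 h2)); zmod_eq.
Qed.

(** Pigeonhole: each failing [w j] yields a position in [F] and a code at most [n]; two of them
    would share these data and be congruent modulo [N d]. *)
Lemma stage_avoid d s (F : seq G) n : stage d -> lt s d ->
  exists w, N s w /\ forall u, u \in F -> (n < h d (w + u))%N.
Proof.
move=> dS sd; have [w [wN wd]] := stage_incongruent dS sd.
apply: contrapT => nw.
have /choice[p pP] : forall j, exists p : 'I_(size F) * 'I_n.+1,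
    h d (w j + F`_p.1) = p.2.
  move=> j; apply: contrapT => np; apply: nw; exists (w j); split=> // u uF.
  rewrite ltnNge; apply/negP => hn; apply: np.
  have iF : (index u F < size F)%N by rewrite index_mem.
  have hn' : (h d (w j + u) < n.+1)%N by rewrite ltnS.
  by exists (Ordinal iF, Ordinal hn'); rewrite /= nth_index.
pose m := #|{: 'I_(size F) * 'I_n.+1}|.
have /leq_card : injective (fun j : 'I_m.+1 => p j).
  move=> i j pij; apply: val_inj; case: (ltngtP i j) => // ij.
    case: (wd _ _ ij); have := pP i; rewrite pij -pP => /hP hw.
    by apply: (Neq hw); zmod_eq.
  case: (wd _ _ ij); have := pP j; rewrite -pij -pP => /hP hw.
  by apply: (Neq hw); zmod_eq.
by rewrite card_ord ltnn.
Qed.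

(** The extension property of Aronszajn trees. The projection of [y] from level [a] to level [s] is
    [e a s + y]; finitely many translates must keep large codes on the way from [b] up to [a]. *)
Definition extendible (e : W -> W -> G) b a := forall x (F : seq G) n,
  exists y, N b (e a b + y - x) /\
    forall u, u \in F -> forall s, stage s -> lt b s -> le s a ->
      (n < h s (e a s + y + u))%N.

Definition escaping (e : W -> W -> G) d := forall u n,
  exists b, lt b d /\
    forall s, stage s -> lt b s -> lt s d -> (n < h s (e d s + u))%N.

Let coset_enum d : exists g : nat -> G, forall x, exists i, N d (x - g i).
Proof.
have /choice[g gP] : forall i, exists x, forall y, h d y = i -> h d x = i.
  move=> i; case: (pselect (exists x, h d x = i)) => [[x xi]|nx]; first by exists x.
  by exists 0 => y yi; case: nx; exists y.
by exists g => x; exists (h d x); apply/hP; rewrite (gP _ x).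
Qed.

(** The row is built along a cofinal sequence. Step [k] answers the [k]-th instance of extendibility
    by a translate of the row, and enlarges a finite list of translates whose codes stay above a
    growing bound from then on. Representatives of all cosets of [N d] enter the list, whence
    [escaping]. *)
Lemma countable_limit_step d e : is_limit lt d ->
  (forall t, lt t d -> cocycle_at lt N e t) ->
  (forall a b, lt a d -> lt b a -> extendible e b a) ->
  exists x, [/\ cocycle_at lt N (upd e d x) d,
    forall b, lt b d -> extendible (upd e d x) b d & escaping (upd e d x) d].
Proof.
move=> dl cd ed; have [g gP] := coset_enum d; have [c [cltd cP]] := limit_enum HW dl.
(* A request consists of a level, a target, finitely many translates and a bound, given by indices
   into [c] and [g]. *)
pose K : countType := (nat * nat * seq nat * nat)%type.
pose k0 : K := (0, 0, [::], 0)%N; pose req k : K := odflt k0 (unpickle k).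
have reqP (q : K) : exists k, req k = q by exists (pickle q); rewrite /req pickleK.
pose B k := c (req k).1.1.1; pose X k := g (req k).1.1.2.
pose F k := map g (req k).1.2; pose n k := (req k).2.
case: (@limit_seq _ _ HW d (fun _ _ => True) B dl) => //.
- by move=> k; apply: cltd.
- by move=> x xd; case: dl => _ /(_ _ xd)[y []]; exists y.
move=> s [sI sd Bs _].
have scof : cofinal_in lt s d.
  split=> // x /cP[i ci]; case: (reqP (i, 0, [::], 0)%N) => k kE.
  by exists k; have := Bs k; rewrite /B kE /= ci.
(* A state is a node at level [s k], the translates promised to stay above the bound, the bound. *)
pose next k (st st' : G * seq G * nat) :=
  (exists v,
   [/\ N (B k) (e (s k) (B k) + (st.1.1 + v) - X k),
       forall u, u \in F k -> forall r, stage r -> lt (B k) r -> le r (s k) ->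
         (n k < h r (e (s k) r + (st.1.1 + v) + u))%N,
       stage d -> forall u, u \in F k -> (n k < h d (v + u))%N,
       forall u, u \in F k -> v + u \in st'.1.2 &
       (n k <= st'.2)%N]) /\
  [/\ g k \in st'.1.2, {subset st.1.2 <= st'.1.2}, (maxn k st.2 <= st'.2)%N,
      N (s k) (e (s k.+1) (s k) + st'.1.1 - st.1.1) &
      forall u, u \in st'.1.2 -> forall r, stage r -> lt (s k) r -> le r (s k.+1) ->
         (st'.2 < h r (e (s k.+1) r + st'.1.1 + u))%N].
have /choice[f fP] : forall p : nat * (G * seq G * nat), exists st', next p.1 p.2 st'.
  (* [y] answers request [k] up to level [s k]; a correction [w] in [N (s k)] keeps the codes there
     and, if [d] is a stage, enlarges those at [d]. *)
  case=> k [[b L] M] /=; have [y [yN yF]] := ed _ _ (sd k) (Bs k) (X k) (F k) (n k).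
  have [w [wN wF]] : exists w, N (s k) w /\
      (stage d -> forall u, u \in F k -> (n k < h d (y - b + w + u))%N).
    case: (pselect (stage d)) => dS; last by exists 0.
    have [w [wN wF]] := @stage_avoid d (s k) [seq y - b + u | u <- F k] (n k) dS (sd k).
    exists w; split=> // _ u uF; have := wF _ (map_f (fun u => y - b + u) uF).
    by congr (_ < h d _)%N; zmod_eq.
  pose v := y - b + w; pose L' := g k :: [seq v + u | u <- F k] ++ L.
  pose M' := maxn (n k) (maxn k M).
  (* The old node [b], not its translate, is extended; the translate survives as a promise in
     [L']. *)
  have [b' [b'N b'L]] := ed _ _ (sd k.+1) (sI k) b L' M'.
  exists (b', L', M'); split; last first.
    split=> //=; first by rewrite /L' mem_head.
      by move=> u uL; rewrite /L' inE mem_cat uL !orbT.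
    by rewrite /M' leq_maxr.
  exists v; split=> //=.
  - have h1 := Nlt (Bs k) wN.
    by apply: (Neq (ND yN h1)); rewrite /v; zmod_eq.
  - move=> u uF r rS Br rs; rewrite (@h_congr r _ (e (s k) r + y + u)); first exact: yF.
    by apply: (Neq (Nle rs wN)); rewrite /v; zmod_eq.
  - by move=> u uF; rewrite /L' inE mem_cat map_f ?orbT.
  - by rewrite /M' leq_maxl.
have [st stP] : exists st, forall k, next k (st k) (st k.+1).
  exists (fix st k := if k is k'.+1 then f (k', st k') else (0, [::], 0%N)) => k.
  exact: (fP (k, _)).
pose t k := (st k).1.1.
have tP k : N (s k) (t k - (e (s k.+1) (s k) + t k.+1)).
  by case: (stP k) => _ [_ _ _ tk _]; apply: (Neq (NN tk)); rewrite /t; zmod_eq.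
have [x [xd xc xt]] := cocycle_glue HW N0 NB Nlt cd scof tP.
have stmon j k : (j <= k)%N ->
    {subset (st j).1.2 <= (st k).1.2} /\ ((st j).2 <= (st k).2)%N.
  elim: k => [|k IH]; first by rewrite leqn0 => /eqP ->; split.
  rewrite leq_eqVlt => /predU1P[->|]; first by split.
  rewrite ltnS => /IH[jL jM].
  case: (stP k) => _ [_ kL kM _ _]; split; first by move=> u /jL/kL.
  by apply: (leq_trans jM); apply: leq_trans kM; rewrite leq_maxr.
(* The step [m] with [r] above [s m] and at most [s m.+1] kept the promise at [r]. *)
have promise j u r : u \in (st j.+1).1.2 -> stage r -> lt (s j) r -> lt r d ->
    ((st j.+1).2 < h r (x r + u))%N.
  move=> uL rS jr rd.
  have exm : exists m, `[< le r (s m) >].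
    by case: scof => _ _ /(_ _ rd)[m rm]; exists m; apply/asboolP; right.
  case: (ex_minnP exm) => -[|m] /asboolP rm mmin.
    case: (lt_nle HW jr); case: rm => [->|rm]; first exact: increasing_le.
    by right; apply: (lt_le_trans HW) rm (increasing_le HW sI _).
  have mr : lt (s m) r.
    apply: contrapT => /(nlt_le HW) rm'.
    by have := mmin m (asboolT rm'); rewrite ltnn.
  have jm : (j <= m)%N.
    rewrite leqNgt; apply/negP => mj; apply: (lt_nle HW jr).
    case: rm => [->|rm]; first exact: increasing_le.
    by right; apply: (lt_le_trans HW) rm (increasing_le HW sI mj).
  have [jmL jmM] := stmon j.+1 m.+1 jm.
  case: (stP m) => _ [_ _ _ _ /(_ _ (jmL _ uL) _ rS mr rm)].
  rewrite -(@h_congr r (x r + u)); first exact: leq_trans.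
  by apply: (Neq (xt _ _ rm)); rewrite /t; zmod_eq.
exists x; split=> //; last first.
  move=> u m; case: (gP u) => i ui; pose j := maxn i m; exists (s j); split=> // r rS jr rd.
  rewrite upd_same (@h_congr r _ (x r + g i)); last first.
    by apply: (Neq (Nlt rd ui)); zmod_eq.
  have gL : g i \in (st j.+1).1.2.
    have [+ _] := stmon i.+1 j.+1 (leq_maxl i m); apply.
    by case: (stP i) => _ [].
  apply: leq_ltn_trans (promise _ _ _ gL rS jr rd).
  case: (stP j) => _ [_ _ jM _ _]; apply: leq_trans jM.
  by rewrite leq_max leq_maxr.
move=> b bd y Fy m.
have [iB iBE] := cP _ bd; have [iX iXE] := gP y.
have /choice[ig igP] := gP.
have [k kE] := reqP (iB, iX, map ig Fy, m).
have Bk : B k = b by rewrite /B kE /= iBE.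
have nk : n k = m by rewrite /n kE.
have FkP u : u \in Fy -> g (ig u) \in F k by move=> uF; rewrite /F kE map_f // map_f.
case: (stP k) => -[v]; rewrite Bk nk => -[vN vF vd vL vM] _.
have bsk : lt b (s k) by rewrite -Bk.
exists v; rewrite upd_same; split.
  have h1 := xt k b (or_intror bsk).
  have h2 : N b (g iX - y) by apply: (Neq (NN (Nlt bd iXE))); zmod_eq.
  have h3 : N b (e (s k) b + ((st k).1.1 + v) - g iX) by move: vN; rewrite /X kE.
  by apply: (Neq (ND (ND h1 h3) h2)); rewrite /t; zmod_eq.
(* Three ranges: [r = d], where [x d = 0] and [vd] applies; [r] above [s k], by [promise]; [r] up to
   [s k], by [vF]. *)
move=> u uF r rS br [rd|rd].
  move: rS; rewrite rd xd => dS; have := vd dS _ (FkP _ uF).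
  rewrite (@h_congr d _ (0 + v + u)) //.
  by apply: (Neq (NN (igP u))); zmod_eq.
rewrite (@h_congr r _ (x r + (v + g (ig u)))); last first.
  by apply: (Neq (Nlt rd (igP u))); zmod_eq.
case: (pselect (lt (s k) r)) => [kr|/(nlt_le HW) rk].
  by apply: leq_ltn_trans (promise _ _ _ (vL _ (FkP _ uF)) rS kr rd).
have := vF _ (FkP _ uF) _ rS br rk; congr (_ < _)%N; apply: h_congr.
by apply: (Neq (NN (xt _ _ rk))); rewrite /t; zmod_eq.
Qed.

(** At a successor the row is copied; a successor is no stage, so no new code has to be bounded. *)
Lemma countable_step d e : (forall t, lt t d -> cocycle_at lt N e t) ->
  (forall a b, lt a d -> lt b a -> extendible e b a) ->
  exists x, [/\ cocycle_at lt N (upd e d x) d,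
    forall b, lt b d -> extendible (upd e d x) b d &
    is_limit lt d -> escaping (upd e d x) d].
Proof.
move=> cd ed; case: (zero_succ_limit HW d) => [d0|[g [gd gmax]]|dl].
- exists (fun=> 0); split; first exact: cocycle_at_zero.
    by move=> b /d0.
  by case=> -[x /d0].
- have dnl : ~ is_limit lt d.
    by case=> _ /(_ _ gd)[y [gy /gmax /(lt_nle HW gy)]].
  case: (cocycle_at_succ HW N0 cd gd gmax) => x [_ xc xg]; exists x; split=> //.
  move=> b bd y F n; rewrite upd_same; case: (gmax _ bd) => [bg|bg].
    exists y; split.
      by rewrite bg xg; [case: (cd _ gd) => -> _; apply: (Neq (N0 _)); zmod_eq|left].
    move=> u _ s sS bs [sd|/gmax sg]; first by case: dnl; rewrite -sd; case: sS.
    by case: (lt_nle HW bs); rewrite bg.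
  have [z [zN zF]] := ed _ _ gd bg y F n; exists z; split; first by rewrite xg //; right.
  move=> u uF s sS bs [sd|/gmax sg]; first by case: dnl; rewrite -sd; case: sS.
  by rewrite xg //; apply: zF.
have [x [xc xe xb]] := countable_limit_step dl cd ed; by exists x.
Qed.

Lemma countable_nontrivial : (forall s, exists t, lt s t /\ shrinks s t) ->
  exists e, (forall d, cocycle_at lt N e d) /\ forall c, ~ trivializes lt N e c.
Proof.
move=> shrink.
case: (@transfinite_rows _ _ HW _ (fun=> 0)
  (fun d e => [/\ cocycle_at lt N e d, forall b, lt b d -> extendible e b d &
    is_limit lt d -> escaping e d])) => [d e e' ee' [ce xe be]|d e IH|e eP].
- split; first exact: cocycle_at_local ce.
    by move=> b bd; rewrite /extendible -ee'; [apply: xe|left].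
  by move=> dl; rewrite /escaping -ee'; [apply: be|left].
- apply: countable_step => [t /IH[]|a b ad ba] //.
  by case: (IH _ ad) => _ + _; apply.
exists e; split=> [d|c cP]; first by case: (eP d).
have stage_ub b : exists d, lt b d /\ stage d.
  case: (iterate_limit HW b shrink) => s [d [dl [sI sd scof] bd sQ]].
  exists d; split=> //; split=> // x /scof[n xn]; exists (s n.+1); split=> //.
    exact: (lt_trans HW) xn (sI n).
  case: (sQ n) => y [yn ny]; exists y; split=> //; exact: Nlt xn yn.
pose A n s := stage s /\ (h s (c s) <= n)%N.
(* Otherwise each [n] fails beyond some [b n]; a stage [d] beyond all of these contradicts the case
   [n = h d (c d)]. *)
have [n nA] : exists n, forall b, exists s, lt b s /\ A n s.
  apply: contrapT => nn.
  have /choice[b bP] : forall n, exists b, forall s, lt b s -> ~ A n s.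
    move=> n; apply: contrapT => nb; apply: nn; exists n => b.
    apply: contrapT => ns; apply: nb; exists b => s bs As.
    by apply: ns; exists s.
  have [b' b'P] := seq_bound HW b; have [d [b'd dS]] := stage_ub b'.
  by apply: (bP (h d (c d)) d); [apply: (lt_trans HW) b'd|split].
have [w0 _] : exists w : W, True.
  apply: contrapT => nw; case: HW => _ [_ [_ [_ [+ _]]]]; apply.
  by exists (fun=> 0%N) => x; case: nw; exists x.
(* [d] is a limit of stages with codes at most [n], although the row [e d] escapes along the
   translate [c d]. *)
case: (@iterate_limit _ _ HW w0 (fun _ y => A n y)) => // s [d [dl [sI sd scof] _ sA]].
case: (eP d) => _ _ /(_ dl) /(_ (c d) n)[b [bd bP]].
case: (scof _ bd) => m bm; have [mS mn] := sA m.
have := bP _ mS (lt_trans HW bm (sI m)) (sd _); rewrite ltnNge => /negP; apply.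
by rewrite -(h_congr (cP _ _ (sd m.+1))).
Qed.

End Countable.

(** * Divisibility in a domain *)

Section Divisibility.
Variable R : idomainType.
Implicit Types a b c x y : R.

Lemma dvd0 a : dvd a 0.
Proof. by exists 0; rewrite mul0r. Qed.

Lemma dvdB a x y : dvd a x -> dvd a y -> dvd a (x - y).
Proof. by move=> [u ->] [v ->]; exists (u - v); rewrite mulrBl. Qed.

Lemma dvdD a x y : dvd a x -> dvd a y -> dvd a (x + y).
Proof. by move=> [u ->] [v ->]; exists (u + v); rewrite mulrDl. Qed.

Lemma dvdM a c x : dvd a x -> dvd a (c * x).
Proof. by move=> [u ->]; exists (c * u); rewrite mulrA. Qed.

Lemma dvd_trans b a c : dvd a b -> dvd b c -> dvd a c.
Proof. by move=> [u ->] [v ->]; exists (v * u); rewrite mulrA. Qed.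

Lemma dvd_eq a x y : dvd a y -> x = y -> dvd a x.
Proof. by move=> + ->. Qed.

End Divisibility.

(** * The direct limit of the modules [R / r_s R] *)

Section DirectLimit.
Variables (W : Type) (lt : W -> W -> Prop).
Hypothesis HW : is_omega1 lt.
Variables (R : idomainType) (r : W -> R) (m : W -> W -> R).
Hypothesis m_comp : forall a s t, lt a s -> lt s t -> dvd (r t) (m s t * m a s - m a t).
Hypothesis m_inj : forall s t x, lt s t -> dvd (r t) (m s t * x) <-> dvd (r s) x.

Let T : choiceType := ({classic W} * R)%type.

Let rel (p q : T) (t : W) := dvd (r t) (m p.1 t * p.2 - m q.1 t * q.2).

(** Both comparisons are pushed to a common higher level [z], from which [m_inj] descends to
    [t']. *)
Let rel_indep (p q : T) t t' :
  lt p.1 t -> lt q.1 t -> lt p.1 t' -> lt q.1 t' -> rel p q t -> rel p q t'.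
Proof.
case: p q => [s x] [s' y] /= st s't st' s't' h; rewrite /rel /=.
have [z [tz t'z]] := ub2 HW t t'.
apply/(m_inj _ t'z).
have h1 : dvd (r z) (m t z * (m s t * x - m s' t * y)) by apply/m_inj.
have h2 := dvdM x (m_comp st tz); have h3 := dvdM y (m_comp s't tz).
have h4 := dvdM x (m_comp st' t'z); have h5 := dvdM y (m_comp s't' t'z).
by apply: (dvd_eq (dvdB (dvdD (dvdB (dvdD h1 h3) h2) h4) h5)); ring.
Qed.

Definition dlim_rel (p q : T) : bool :=
  `[< exists t, [/\ lt p.1 t, lt q.1 t & rel p q t] >].

Lemma dlim_relP p q t : lt p.1 t -> lt q.1 t -> dlim_rel p q <-> rel p q t.
Proof.
move=> pt qt; split; last by move=> h; apply/asboolP; exists t.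
by move=> /asboolP[z [pz qz]]; apply: rel_indep.
Qed.

Lemma dlim_rel_equiv : equiv_class_of dlim_rel.
Proof.
split=> [p|p q|q p z].
- have [t [pt _]] := ub2 HW p.1 p.1; apply/(dlim_relP pt pt).
  by apply: (dvd_eq (dvd0 _)); rewrite subrr.
- have [t [pt qt]] := ub2 HW p.1 q.1.
  apply/idP/idP => /(dlim_relP _ _) h; apply/(dlim_relP (t := t)) => //;
  by apply: (dvd_eq (dvdB (dvd0 _) (h t _ _))) => //; rewrite sub0r opprB.
- have [t' [pt' qt']] := ub2 HW p.1 q.1; have [t [t't zt]] := ub2 HW t' z.1.
  have pt := lt_trans HW pt' t't; have qt := lt_trans HW qt' t't.
  move=> /(dlim_relP pt qt) h1 /(dlim_relP qt zt) h2; apply/(dlim_relP pt zt).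
  by apply: (dvd_eq (dvdD h1 h2)); rewrite addrA subrK.
Qed.

Canonical dlim_equiv := EquivRelPack dlim_rel_equiv.

Definition dlim := {eq_quot dlim_rel}%qT.
HB.instance Definition _ := Choice.on dlim.

Definition din (s : W) (x : R) : dlim := (\pi_(dlim) ((s : {classic W}), x))%qT.

Lemma din_eq s x s' y t : lt s t -> lt s' t ->
  din s x = din s' y <-> dvd (r t) (m s t * x - m s' t * y).
Proof.
move=> st s't; have := @dlim_relP (s, x) (s', y) t st s't.
rewrite /rel /= => <-; by split=> [/eqmodP|?]; last apply/eqmodP.
Qed.

Lemma din_trans s t x : lt s t -> din s x = din t (m s t * x).
Proof.
move=> st; have [z [tz _]] := ub2 HW t t; apply/(din_eq _ _ (lt_trans HW st tz) tz).
by apply: (dvd_eq (dvdM (- x) (m_comp st tz))); ring.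
Qed.

Lemma din_level (u : dlim) : exists s, forall t, lt s t -> exists x, u = din t x.
Proof.
have [s [x ->]] : exists s x, u = din s x.
  by elim/quotW: u => -[s x]; exists s, x.
by exists s => t st; exists (m s t * x); apply: din_trans.
Qed.

Lemma din_eq0 s x y : din s x = din s y <-> dvd (r s) (x - y).
Proof.
have [t [st _]] := ub2 HW s s; split.
  by move/(din_eq _ _ st st); rewrite -mulrBr => /(m_inj _ st).
by move=> h; apply/(din_eq _ _ st st); rewrite -mulrBr; apply/(m_inj _ st).
Qed.

Let lev (u : dlim) : W := projT1 (cid (din_level u)).
Let levP u t : lt (lev u) t -> exists x, u = din t x.
Proof. by rewrite /lev; case: cid => s /= h; apply: h. Qed.

(** The first condition makes [f] well defined modulo each [r s], the second makes it commute with
    the transition maps. Negation and scaling count as binary operations that ignore an argument. *)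
Lemma op_exists (f : R -> R -> R) :
  (forall a x x' y y', dvd a (x - x') -> dvd a (y - y') -> dvd a (f x y - f x' y')) ->
  (forall c x y, c * f x y = f (c * x) (c * y)) ->
  exists F : dlim -> dlim -> dlim, forall s x y, F (din s x) (din s y) = din s (f x y).
Proof.
move=> fc fM.
have /choice[F FP] : forall p : dlim * dlim, exists z, forall s x y,
    p.1 = din s x -> p.2 = din s y -> z = din s (f x y).
  case=> u v; have [t0 [ut0 vt0]] := ub2 HW (lev u) (lev v).
  have [x0 ux0] := levP ut0; have [y0 vy0] := levP vt0.
  exists (din t0 (f x0 y0)) => s x y /= us vs.
  have [z [t0z sz]] := ub2 HW t0 s; apply/(din_eq _ _ t0z sz); rewrite !fM.
  by apply: fc; apply/(din_eq _ _ t0z sz); congruence.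
by exists (fun u v => F (u, v)) => s x y; apply: FP.
Qed.
Let add_ex : exists F : dlim -> dlim -> dlim,
  forall s x y, F (din s x) (din s y) = din s (x + y).
Proof.
apply: op_exists => [a x x' y y' h1 h2|c x y]; last exact: mulrDr.
by apply: (dvd_eq (dvdD h1 h2)); ring.
Qed.
Let opp_ex : exists F : dlim -> dlim -> dlim,
  forall s x y, F (din s x) (din s y) = din s (- x).
Proof.
apply: op_exists => [a x x' y y' h1 h2|c x y]; last exact: mulrN.
by apply: (dvd_eq (dvdB (dvd0 _) h1)); ring.
Qed.
Let scale_ex a : exists F : dlim -> dlim -> dlim,
  forall s x y, F (din s x) (din s y) = din s (a * x).
Proof.
apply: op_exists => [b x x' y y' h1 h2|c x y]; last exact: mulrCA.
by apply: (dvd_eq (dvdM a h1)); ring.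
Qed.

Definition dlim_add : dlim -> dlim -> dlim := projT1 (cid add_ex).
Definition dlim_opp (u : dlim) : dlim := projT1 (cid opp_ex) u u.
Definition dlim_scale (a : R) (u : dlim) : dlim := projT1 (cid (scale_ex a)) u u.

Lemma dlim_addE s x y : dlim_add (din s x) (din s y) = din s (x + y).
Proof. by rewrite /dlim_add; case: cid. Qed.
Lemma dlim_oppE s x : dlim_opp (din s x) = din s (- x).
Proof. by rewrite /dlim_opp; case: cid. Qed.
Lemma dlim_scaleE a s x : dlim_scale a (din s x) = din s (a * x).
Proof. by rewrite /dlim_scale; case: cid. Qed.

Variable w0 : W.
Definition dlim_zero := din w0 0.

Lemma din0 s : din s 0 = dlim_zero.
Proof.
have [t [st wt]] := ub2 HW s w0; apply/(din_eq _ _ st wt).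
by apply: (dvd_eq (dvd0 _)); rewrite !mulr0 subrr.
Qed.

Lemma din_level3 u v w : exists s x y z, [/\ u = din s x, v = din s y & w = din s z].
Proof.
have [t1 [ut1 vt1]] := ub2 HW (lev u) (lev v); have [t [t1t wt]] := ub2 HW t1 (lev w).
have [x ux] := levP (lt_trans HW ut1 t1t); have [y vy] := levP (lt_trans HW vt1 t1t).
by have [z wz] := levP wt; exists t, x, y, z.
Qed.

Fact dlim_addA : associative dlim_add.
Proof.
move=> u v w; have [s [x [y [z [-> -> ->]]]]] := din_level3 u v w.
by rewrite !dlim_addE addrA.
Qed.
Fact dlim_addC : commutative dlim_add.
Proof.
move=> u v; have [s [x [y [z [-> -> _]]]]] := din_level3 u v v.
by rewrite !dlim_addE addrC.
Qed.
Fact dlim_add0 : left_id dlim_zero dlim_add.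
Proof.
move=> u; have [s [x [y [z [-> _ _]]]]] := din_level3 u u u.
by rewrite -(din0 s) dlim_addE add0r.
Qed.
Fact dlim_addN : left_inverse dlim_zero dlim_opp dlim_add.
Proof.
move=> u; have [s [x [y [z [-> _ _]]]]] := din_level3 u u u.
by rewrite dlim_oppE dlim_addE addNr din0.
Qed.
HB.instance Definition _ := GRing.isZmodule.Build dlim dlim_addA dlim_addC dlim_add0 dlim_addN.

Fact dlim_scaleA a b u : dlim_scale a (dlim_scale b u) = dlim_scale (a * b) u.
Proof.
have [s [x [y [z [-> _ _]]]]] := din_level3 u u u.
by rewrite !dlim_scaleE mulrA.
Qed.
Fact dlim_scale1 : left_id 1 dlim_scale.
Proof.
move=> u; have [s [x [y [z [-> _ _]]]]] := din_level3 u u u.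
by rewrite !dlim_scaleE mul1r.
Qed.
Fact dlim_scaleDr : right_distributive dlim_scale +%R.
Proof.
move=> a u v; have [s [x [y [z [-> -> _]]]]] := din_level3 u v v.
by rewrite /GRing.add /= !dlim_addE !dlim_scaleE dlim_addE mulrDr.
Qed.
Fact dlim_scaleDl u : {morph dlim_scale^~ u : a b / a + b}.
Proof.
move=> a b; have [s [x [y [z [-> _ _]]]]] := din_level3 u u u.
rewrite !dlim_scaleE; apply: etrans (esym (dlim_addE _ _ _)); by rewrite mulrDl.
Qed.
HB.instance Definition _ :=
  GRing.Zmodule_isLmodule.Build R dlim dlim_scaleA dlim_scale1 dlim_scaleDr dlim_scaleDl.

(** The interface through which the limit is used below; the fourth property embeds each
    [R / r_s R]. *)
Lemma direct_limit : exists (U : lmodType R) (i : W -> R -> U),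
  [/\ forall s x y, i s (x + y) = i s x + i s y,
      forall s a x, i s (a * x) = a *: i s x,
      forall s t x, lt s t -> i s x = i t (m s t * x),
      forall s x, i s x = 0 <-> dvd (r s) x &
      forall u v, exists s x y, u = i s x /\ v = i s y].
Proof.
exists dlim, din; split.
- by move=> s x y; symmetry; apply: dlim_addE.
- by move=> s a x; symmetry; apply: dlim_scaleE.
- exact: din_trans.
- by move=> s x; rewrite -[x in dvd _ x]subr0 -din_eq0 (din0 s).
- move=> u v; have [s [x [y [_ [-> -> _]]]]] := din_level3 u v v; by exists s, x, y.
Qed.

End DirectLimit.

(** * Fractions and units over a valuation domain *)

Section Valuation.
Variable R : idomainType.
Implicit Types a b p x y : R.

Lemma embM x y : emb (x * y) = emb x * emb y. Proof. exact: tofracM. Qed.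
Lemma embB x y : emb (x - y) = emb x - emb y. Proof. exact: tofracB. Qed.
Lemma emb_eq0 x : (emb x == 0) = (x == 0). Proof. exact: tofrac_eq0. Qed.
Lemma emb_inj : injective (@emb R).
Proof. by move=> x y /eqP; rewrite tofrac_eq => /eqP. Qed.

Lemma frac_repr (x : {fraction R}) : exists a b, b != 0 /\ x = emb a / emb b.
Proof.
suff [a [b [b0 xb]]] : exists a b, b != 0 /\ x * emb b = emb a.
  by exists a, b; split=> //; rewrite -xb mulfK // emb_eq0.
elim/quotW: x => y; exists (\n_y), (\d_y); split; first exact: denom_ratioP.
rewrite /emb !piE; apply/eqmodP.
rewrite /= FracField.equivfE /FracField.mulf /= !numden_Ratio ?mulf_neq0 ?oner_eq0 ?denom_ratioP //.
by rewrite !mulr1 mulrC.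
Qed.

Hypothesis vR : valuation_domain R.

Lemma vd_total a b : dvd a b \/ dvd b a.
Proof.
have I (c : R) : is_ideal (dvd c).
  by split; [apply: dvd0|move=> x y; apply: dvdD|move=> x y; apply: dvdM].
have self (c : R) : dvd c c by exists 1; rewrite mul1r.
by case: (vR (I a) (I b)) => h; [right|left]; apply: h.
Qed.

Lemma frac_total (x y : {fraction R}) : (exists c, x = emb c * y) \/ exists c, y = emb c * x.
Proof.
have [a [b [b0 ->]]] := frac_repr x; have [c [d [d0 ->]]] := frac_repr y.
have eb : emb b != 0 by rewrite emb_eq0.
have ed : emb d != 0 by rewrite emb_eq0.
have key (u v : R) (z z' : {fraction R}) :
    dvd u v -> z = emb v / (emb b * emb d) -> z' = emb u / (emb b * emb d) -> exists k, z = emb k * z'.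
  by move=> [k ->] -> ->; exists k; rewrite embM mulrA.
have xE : emb a / emb b = emb (a * d) / (emb b * emb d)
  by rewrite embM -mulf_div divff // mulr1.
have yE : emb c / emb d = emb (c * b) / (emb b * emb d)
  by rewrite embM [emb b * _]mulrC -mulf_div divff // mulr1.
by case: (vd_total (a * d) (c * b)) => /key h; [right|left]; apply: h.
Qed.

Lemma unit_dvd u x : u \is a GRing.unit -> dvd u x.
Proof. by move=> uu; exists (x / u); rewrite divrK. Qed.

Lemma dvd_unit u x : dvd u x -> x \is a GRing.unit -> u \is a GRing.unit.
Proof. by move=> [c ->]; rewrite unitrM => /andP[]. Qed.

(** If [p] divided [x], it would divide 1. So [p = c * x], and with [x - 1 = t * p] the inverse of
    [x] is [1 - t * c]. *)
Lemma unit_near1 p x : p \isn't a GRing.unit -> dvd p (x - 1) -> x \is a GRing.unit.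
Proof.
move=> pn [t xt]; case: (vd_total p x) => [px|[c pc]].
  case/negP: pn; apply: (@dvd_unit _ 1) (unitr1 _).
  by apply: (dvd_eq (dvdB px (ex_intro _ t xt))); ring.
apply/unitrP; exists (1 - t * c).
have E : (1 - t * c) * x = 1.
  by rewrite mulrBl mul1r -mulrA -pc -xt; ring.
by split=> //; rewrite mulrC.
Qed.

End Valuation.

(** * The group of units congruent to 1 *)

Section NearOne.
Variables (R : idomainType) (p : R).

Definition is_near1 (x : R) : bool := (x \is a GRing.unit) && `[< dvd p (x - 1) >].
Definition near1 := {x : R | is_near1 x}.
HB.instance Definition _ := Choice.on near1.

Implicit Types u v w : near1.

Lemma near1_unit u : val u \is a GRing.unit.
Proof. by case: u => x /= /andP[]. Qed.

Lemma near1_dvd u : dvd p (val u - 1).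
Proof. by case: u => x /= /andP[_ /asboolP]. Qed.

Fact near1_mul_proof u v : is_near1 (val u * val v).
Proof.
case: u v => x /andP[xu /asboolP xp] [y /andP[yu /asboolP yp]] /=.
rewrite /is_near1 unitrM xu yu /=; apply/asboolP.
by apply: (dvd_eq (dvdD (dvdM x yp) xp)); ring.
Qed.
Definition near1_mul u v : near1 := exist (fun x => is_near1 x) _ (near1_mul_proof u v).

Fact near1_one_proof : is_near1 1.
Proof. by rewrite /is_near1 unitr1; apply/asboolP; rewrite subrr; apply: dvd0. Qed.
Definition near1_one : near1 := exist (fun x => is_near1 x) _ near1_one_proof.

Fact near1_inv_proof u : is_near1 (val u)^-1.
Proof.
case: u => x /andP[xu /asboolP xp] /=; rewrite /is_near1 unitrV xu /=; apply/asboolP.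
by apply: (dvd_eq (dvdM (- x^-1) xp)); rewrite mulrBr mulNr mulVr //; ring.
Qed.
Definition near1_inv u : near1 := exist (fun x => is_near1 x) _ (near1_inv_proof u).

Fact near1_mulA : associative near1_mul.
Proof. by move=> u v w; apply: val_inj; rewrite /= mulrA. Qed.
Fact near1_mulC : commutative near1_mul.
Proof. by move=> u v; apply: val_inj; rewrite /= mulrC. Qed.
Fact near1_mul1 : left_id near1_one near1_mul.
Proof. by move=> u; apply: val_inj; rewrite /= mul1r. Qed.
Fact near1_mulV : left_inverse near1_one near1_inv near1_mul.
Proof. by move=> u; apply: val_inj; rewrite /= mulVr // near1_unit. Qed.
(* The multiplicative group [1 + pR], written additively. *)
HB.instance Definition _ :=
  GRing.isZmodule.Build near1 near1_mulA near1_mulC near1_mul1 near1_mulV.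

Lemma near1_0 : val (0 : near1) = 1. Proof. by []. Qed.
Lemma near1_D u v : val (u + v) = val u * val v. Proof. by []. Qed.
Lemma near1_B u v : val (u - v) = val u / val v. Proof. by []. Qed.

Lemma near1_dvdB a u v : dvd a (val (u - v) - 1) <-> dvd a (val u - val v).
Proof.
have uv := near1_unit v; rewrite near1_B; split=> [h|h].
  by apply: (dvd_eq (dvdM (val v) h)); rewrite mulrBr mulr1 mulrC divrK.
apply: (dvd_eq (dvdM (val v)^-1 h)).
by rewrite mulrBr mulVr // mulrC.
Qed.

End NearOne.

(** * A nontrivial cocycle of units *)

(** Taking the least code in each coset makes the code constant on cosets. *)
Lemma coset_code (G : zmodType) (N : G -> Prop) (h : G -> nat) :
  N 0 -> (forall x y, N x -> N y -> N (x - y)) ->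
  (forall x y, h x = h y -> N (x - y)) ->
  exists h' : G -> nat, forall x y, h' x = h' y <-> N (x - y).
Proof.
move=> N0 NB hN.
have ex x : exists n, `[< exists y, N (x - y) /\ h y = n >].
  by exists (h x); apply/asboolP; exists x; rewrite subrr.
have hP x : exists y, N (x - y) /\ h y = ex_minn (ex x).
  by case: ex_minnP => n /asboolP.
exists (fun x => ex_minn (ex x)) => x y; split=> [E|xy].
  have [x' [xx' hx']] := hP x; have [y' [yy' hy']] := hP y.
  have x'y' : N (x' - y') by apply: hN; congruence.
  have -> : x - y = (x - x') - ((y - y') - (x' - y')) by zmod_eq.
  exact: (NB _ _ xx' (NB _ _ yy' x'y')).
apply: eq_ex_minn => n; apply/asboolP/asboolP => -[z [zN hz]]; exists z; split=> //.
  have -> : y - z = (x - z) - (x - y) by zmod_eq.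
  exact: NB.
have -> : x - z = (x - y) - (0 - (y - z)) by zmod_eq.
exact: (NB _ _ xy (NB _ _ N0 zN)).
Qed.

Section UnitCocycle.
Variables (W : Type) (lt : W -> W -> Prop).
Hypothesis HW : is_omega1 lt.
Hypothesis nCH : not_CH W.
Variables (R : idomainType) (iota : R -> W) (r : W -> R).
Hypothesis vR : valuation_domain R.
Hypothesis iota_inj : injective iota.
Hypothesis r_dvd : forall s t, lt s t -> dvd (r s) (r t).
Hypothesis r_strict : forall s, exists t, lt s t /\ ~ dvd (r t) (r s).

Lemma nonunit_mon s t : le lt s t -> r s \isn't a GRing.unit -> r t \isn't a GRing.unit.
Proof. by case=> [->//|/r_dvd st]; apply: contra; apply: dvd_unit. Qed.

Lemma nonunit_ex : exists s, r s \isn't a GRing.unit.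
Proof.
have [t [_ nt]] := r_strict (iota 0).
by exists t; apply/negP => tu; apply/nt/unit_dvd.
Qed.

Section Base.
Variable s0 : W.
Hypothesis ns0 : r s0 \isn't a GRing.unit.

Let V := near1 (r s0).
Let N s (v : V) := dvd (r s) (val v - 1).

Let N0 s : N s 0.
Proof. by rewrite /N near1_0 subrr; apply: dvd0. Qed.

Let NBP s u v : N s (u - v) <-> dvd (r s) (val u - val v).
Proof. exact: near1_dvdB. Qed.

Let NB s u v : N s u -> N s v -> N s (u - v).
Proof. by move=> nu nv; apply/NBP; apply: (dvd_eq (dvdB nu nv)); rewrite opprB addrA subrK. Qed.

Let Nlt s t v : lt s t -> N t v -> N s v.
Proof. by move=> /r_dvd st; apply: dvd_trans. Qed.

Let lift1 s x : le lt s0 s -> dvd (r s) (x - 1) -> exists v : V, val v = x.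
Proof.
move=> s0s sx; have x0 : dvd (r s0) (x - 1).
  by case: s0s sx => [->//|/r_dvd h]; apply: dvd_trans.
have xP : is_near1 (r s0) x.
  by apply/andP; split; [apply: unit_near1 x0|apply/asboolP].
by exists (exist (fun x => is_near1 (r s0) x) x xP).
Qed.

Let above s : exists s', lt s s' /\ le lt s0 s'.
Proof. by have [s' [? ?]] := ub2 HW s s0; exists s'; split=> //; right. Qed.

(** The last clause excludes trivializations by arbitrary units, since these are what an isomorphism
    with a standard module would provide. *)
Definition cocycle_mod (e : W -> W -> R) :=
  [/\ forall d s, dvd (r s0) (e d s - 1),
      forall a s t, lt a s -> lt s t -> dvd (r a) (e t a - e s a * e t s) &
      forall c, (forall s, c s \is a GRing.unit) ->
        ~ forall s t, lt s t -> dvd (r s) (c s - e t s * c t)].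

(** A trivialization [c] is normalized to [c t / c s0], which is congruent to 1 modulo [r s0]
    because [e t s0] is. Below [s0] all elements of [V] are congruent modulo [r s]. *)
Lemma cocycle_mod_of_near1 :
  (exists e : W -> W -> V, (forall d, cocycle_at lt N e d) /\
     forall c, ~ trivializes lt N e c) -> exists e, cocycle_mod e.
Proof.
move=> [e [ec en]]; exists (fun d s => val (e d s)); split.
- by move=> d s; apply: near1_dvd.
- by move=> a s t as_ st; case: (ec t) => _ /(_ _ _ as_ st) /NBP.
move=> c cu cP.
have cs0 t : lt s0 t -> dvd (r s0) (c t / c s0 - 1).
  move=> s0t; move: (cP _ _ s0t) (near1_dvd (e t s0)).
  move: (val (e t s0)) => x h1 h2.
  apply: (dvd_eq (dvdM (- (c s0)^-1) (dvdD h1 (dvdM (c t) h2)))).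
  rewrite mulNr (_ : c s0 - x * c t + c t * (x - 1) = c s0 - c t); last by ring.
  by rewrite mulrBr mulVr // opprB mulrC.
have /choice[c' c'P] : forall s, exists v : V, le lt s0 s -> val v = c s / c s0.
  move=> s; case: (pselect (lt s0 s)) => [s0s|ns].
    by have [v vE] := lift1 (or_introl erefl) (cs0 _ s0s); exists v.
  exists 0; case=> [->|//]; by rewrite near1_0 divrr.
apply: (en c') => s t st.
have [ss0|s0s] : lt s s0 \/ le lt s0 s.
  by case: (lt_tri HW s s0) => [?|->|?]; [left|right; left|right; right].
  exact: dvd_trans (r_dvd ss0) (near1_dvd _).
apply/NBP; rewrite near1_D !c'P //; last by right; apply: (le_lt_trans HW) s0s st.
by move: (cP _ _ st); move: (val (e t s)) => x h; apply: (dvd_eq (dvdM (c s0)^-1 h)); ring.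
Qed.

Definition countable_mod1 s t := exists h : R -> nat, forall x y,
  dvd (r s) (x - 1) -> dvd (r s) (y - 1) -> h x = h y -> dvd (r t) (x - y).

Lemma countable_case : (forall t, lt s0 t -> countable_mod1 s0 t) ->
  exists e, cocycle_mod e.
Proof.
move=> cnt; apply: cocycle_mod_of_near1.
(* Up to level [s0] the subgroup [N s] is all of [V], so a constant code serves. *)
have /choice[h hP] : forall s, exists h : V -> nat, forall x y, h x = h y <-> N s (x - y).
  move=> s; case: (lt_tri HW s s0) => [ss0|->|/cnt[h hP]].
  - by exists (fun=> 0%N) => x y; split=> // _; apply: dvd_trans (r_dvd ss0) (near1_dvd _).
  - by exists (fun=> 0%N) => x y; split=> // _; apply: near1_dvd.
  apply: (@coset_code V (N s) (fun v => h (val v))) => [|x y|x y hxy]; [exact: N0|exact: NB|].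
  by apply/NBP; apply: hP => //; apply: near1_dvd.
apply: (countable_nontrivial HW N0 NB Nlt hP) => s.
have [s' [ss' s0s']] := above s; have [t [s't nt]] := r_strict s'.
exists t; split; first exact: (lt_trans HW) ss' s't.
(* [1 + r s'] witnesses the shrinking, as [r t] does not divide [r s']. *)
have s'1 : dvd (r s') (1 + r s' - 1) by exists 1; ring.
have [v vE] := lift1 s0s' s'1; exists v; split.
  by apply: (Nlt ss'); rewrite /N vE.
by rewrite /N vE (_ : 1 + _ - 1 = r s') //; ring.
Qed.

Lemma uncountable_case : (forall s, r s \isn't a GRing.unit ->
    exists t, lt s t /\ ~ countable_mod1 s t) ->
  exists e, cocycle_mod e.
Proof.
move=> unc; apply: cocycle_mod_of_near1.
have vinj : injective (fun v : V => iota (val v)) by move=> x y /iota_inj /val_inj.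
apply: (uncountable_nontrivial HW N0 NB Nlt vinj nCH) => s.
have [s' [ss' s0s']] := above s; have [t [s't nt]] := unc _ (nonunit_mon s0s' ns0).
exists t; split; first exact: (lt_trans HW) ss' s't.
move=> [h hP]; apply: nt.
exists (fun x => if insub x is Some v then h v else 0%N) => x y sx sy.
have [u uE] := lift1 s0s' sx; have [v vE] := lift1 s0s' sy.
rewrite -uE -vE !valK => /hP h'; apply/NBP/h'; apply: (Nlt ss').
  by rewrite /N uE.
by rewrite /N vE.
Qed.

End Base.

(** Either some nonunit level has only countable quotients above it, and serves as base, or every
    nonunit level has an uncountable one above it. *)
Lemma cocycle_ex : exists s0 e, r s0 \isn't a GRing.unit /\ cocycle_mod s0 e.
Proof.
case: (pselect (exists s0, r s0 \isn't a GRing.unit /\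
                  forall t, lt s0 t -> countable_mod1 s0 t)) => [[s0 [ns0 cnt]]|ncnt].
  by have [e eP] := countable_case ns0 cnt; exists s0, e.
have [s0 ns0] := nonunit_ex; have [|e eP] := uncountable_case ns0; last by exists s0, e.
move=> s ns; apply: contrapT => nt; apply: ncnt; exists s; split=> // t st.
by apply: contrapT => nc; apply: nt; exists t.
Qed.

End UnitCocycle.

(** * The module glued along a cocycle of units *)

Lemma div_cross (F : fieldType) (a b c s t : F) :
  b != 0 -> t != 0 -> t * a = s * b -> a * (c / b) = c * s / t.
Proof.
move=> b0 t0 E; apply: (mulfI t0); rewrite [LHS]mulrA E.
by field; rewrite b0 t0.
Qed.

Lemma div_scale (F : fieldType) (a b c w : F) :
  w != 0 -> b != 0 -> c != 0 -> a / b / c = a * w / (w * b * c).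
Proof. by move=> w0 b0 c0; field; rewrite w0 b0 c0. Qed.

Section TwistedModule.
Variables (W : Type) (lt : W -> W -> Prop).
Hypothesis HW : is_omega1 lt.
Variables (R : idomainType) (r : W -> R) (s0 : W) (e : W -> W -> R).
Hypothesis vR : valuation_domain R.
Hypothesis r_neq0 : forall s, r s != 0.
Hypothesis r_dvd : forall s t, lt s t -> dvd (r s) (r t).
Hypothesis ns0 : r s0 \isn't a GRing.unit.
Hypothesis e_cocycle : cocycle_mod lt r s0 e.

Let e_near1 d s : dvd (r s0) (e d s - 1).
Proof. by case: e_cocycle. Qed.
Let e_unit d s : e d s \is a GRing.unit.
Proof. exact: unit_near1 (e_near1 d s). Qed.

Variable q : W -> W -> R.
Hypothesis qP : forall s t, lt s t -> r t = q s t * r s.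

Let q_neq0 s t : lt s t -> q s t != 0.
Proof. by move=> /qP rt; apply: contra_neq (r_neq0 t) => q0; rewrite rt q0 mul0r. Qed.

Definition transition s t := e t s * q s t.
Local Notation m := transition.

Let q_comp a s t : lt a s -> lt s t -> q a t = q s t * q a s.
Proof.
move=> as_ st; apply: (mulIf (r_neq0 a)); rewrite -mulrA -!qP //.
exact: (lt_trans HW) as_ st.
Qed.

(** The cocycle congruence modulo [r a], multiplied by [q a t], becomes one modulo [r t]. *)
Lemma twisted_comp a s t : lt a s -> lt s t -> dvd (r t) (m s t * m a s - m a t).
Proof.
move=> as_ st; have at_ := lt_trans HW as_ st.
case: e_cocycle => _ /(_ _ _ _ as_ st)[k kE] _; exists (- k).
rewrite (qP at_) (_ : - k * (q a t * r a) = - (q a t * (k * r a))); last by ring.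
by rewrite -kE /transition (q_comp as_ st); ring.
Qed.

Lemma twisted_inj s t x : lt s t -> dvd (r t) (m s t * x) <-> dvd (r s) x.
Proof.
move=> st; rewrite /transition (qP st); split=> [[k kE]|[k ->]]; last by exists (e t s * k); ring.
exists (k / e t s); apply: (mulfI (q_neq0 st)); apply: (mulrI (e_unit t s)).
transitivity (e t s * q s t * x); first by ring.
rewrite kE; transitivity (q s t * r s * (k / e t s * e t s)); last by ring.
by rewrite divrK //; ring.
Qed.

Section Props.
Variables (U : lmodType R) (i : W -> R -> U).
Hypothesis iD : forall s x y, i s (x + y) = i s x + i s y.
Hypothesis iZ : forall s a x, i s (a * x) = a *: i s x.
Hypothesis iT : forall s t x, lt s t -> i s x = i t (m s t * x).
Hypothesis i0 : forall s x, i s x = 0 <-> dvd (r s) x.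
Hypothesis iL : forall u v, exists s x y, u = i s x /\ v = i s y.

Lemma twisted_uniserial : uniserial U.
Proof.
move=> A B [A0 AD AZ] [B0 BD BZ].
case: (pselect (forall x, A x -> B x)) => [|/existsNP[x /not_implyP[Ax nBx]]]; first by left.
right=> y By; have [s [a [b [xE yE]]]] := iL x y.
case: (vd_total vR a b) => -[c cE].
  by rewrite yE cE iZ -xE; apply: AZ.
by case: nBx; rewrite xE cE iZ -yE; apply: BZ.
Qed.

Let i1_neq0 s : r s \isn't a GRing.unit -> i s 1 <> 0.
Proof. by move=> /negP ns /i0 h; apply/ns/(dvd_unit h)/unitr1. Qed.

(** The element [i s0 1] has annihilator [r_s0 R] and [Dset] equal to [r_s0 J]; the isomorphism is
    multiplication by [r s0]. *)
Lemma twisted_has_type (J : {fraction R} -> Prop) :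
  (forall x, J x <-> exists s, exists c : R, x = emb c / emb (r s)) ->
  has_type U J (@Rpart R).
Proof.
move=> JP; exists (i s0 1); split; first by apply/eqP/i1_neq0.
pose r0 := emb (r s0); have r0n : r0 != 0 by rewrite emb_eq0.
have B0 x : x = 0 -> exists2 a, Ann (i s0 1) a & x = emb a.
  by move=> ->; exists 0; [rewrite /Ann scale0r|rewrite /emb tofrac0].
exists (fun x => r0 * x); split.
- move=> x /JP[s [c ->]]; have [t [st s0t]] := ub2 HW s s0; exists (q s0 t); split.
  + exact: q_neq0.
  + exists (i t (e t s0)); rewrite (iT _ s0t) -iZ; congr (i t _); rewrite /transition; ring.
  exists (c * q s t).
  have qn : emb (q s0 t) != 0 by rewrite emb_eq0 q_neq0.
  have rn : emb (r s) != 0 by rewrite emb_eq0.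
  by rewrite embM; apply: div_cross => //; rewrite -!embM -!qP.
- by move=> x y _ _; apply: B0; rewrite mulrDr subrr.
- by move=> a x _; apply: B0; rewrite mulrCA subrr.
- move=> _ [rho [rhon [u uE] [c ->]]]; exists (emb c / emb rho / r0); last first.
    by apply: B0; rewrite mulrC divfK // subrr.
  apply/JP; have [s [z [_ [uz _]]]] := iL u u.
  have [t [st s0t]] := ub2 HW s s0; exists t.
  move: uE; rewrite uz (iT _ st) (iT _ s0t) -iZ => E.
  have {}E : dvd (r t) (rho * (m s t * z) - m s0 t * 1).
    by apply/i0; rewrite -mulN1r iD E [i t (-1 * _)]iZ scaleN1r subrr.
  case: E => k; rewrite (qP s0t) /transition => E.
  (* At level [t], [rho *: u = i s0 1] reads [rho * y = q s0 t * w] with [w] congruent to 1 modulo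
     [r s0], hence a unit; so [rho] divides [q s0 t]. *)
  set y := e t s * q s t * z in E; pose w := e t s0 + k * r s0.
  have wu : w \is a GRing.unit.
    apply: (unit_near1 vR ns0); apply: (dvd_eq (dvdD (e_near1 t s0) (ex_intro _ k erefl))).
    by rewrite /w; ring.
  have yw : rho * y = q s0 t * w.
    by apply/eqP; rewrite -subr_eq0; apply/eqP; transitivity (rho * y - e t s0 * q s0 t * 1 - k * (q s0 t * r s0)); [rewrite /w; ring|rewrite E subrr].
  have qE : q s0 t = y / w * rho.
    by apply: (mulIr wu); rewrite -yw mulrAC divrK // mulrC.
  exists (c * (y / w)).
  have rn : emb rho != 0 by rewrite emb_eq0.
  have ywn : emb (y / w) != 0.
    rewrite emb_eq0; apply: contra_neq (q_neq0 s0t) => yw0.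
    by rewrite qE yw0 mul0r.
  by move: (y / w) qE ywn => v -> ywn; rewrite !embM; apply: div_scale.
- move=> x _; split=> [[a aA xE]|[a ->]].
    have : dvd (r s0) a by apply/i0; rewrite -[a]mulr1 iZ.
    move=> [b bE]; exists b; apply: (mulfI r0n); rewrite xE bE embM mulrC //.
  exists (r s0 * a); last by rewrite embM.
  by rewrite /Ann -iZ; apply/i0; exists a; rewrite mulr1 mulrC.
Qed.

(** Let [y s] lift [i s 1]. For a nonunit [r s], the module [A] is generated by [r s * y s], so
    these generators are unit multiples [c s] of [z]. The gluing relation between [y s] and [y t]
    then makes [c] a trivialization of [e]. *)
Lemma twisted_nonstandard : ~ standard U.
Proof.
move=> [J' [A [[J0 JD JZ] [A0 AD AZ] AJ [f [fD fZ fS fA]]]]].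
have /choice[y yP] : forall s, exists y, J' y /\ f y = i s 1.
  by move=> s; have [y ? ?] := fS (i s 1); exists y.
have JB x x' : J' x -> J' x' -> J' (x - x').
  move=> Jx Jx'; apply: JD => //; have := JZ (-1) _ Jx'.
  by rewrite /emb tofracN tofrac1 mulN1r.
have Ar s : A (emb (r s) * y s).
  have [Jy fy] := yP s; apply/(fA _ (JZ (r s) _ Jy)); rewrite fZ // fy -iZ.
  by apply/i0; exists 1; ring.
have Agen s x : r s \isn't a GRing.unit -> A x -> exists c, x = emb c * (emb (r s) * y s).
  move=> ns Ax; have [Jy fy] := yP s; have fx : f x = 0 by apply/fA => //; apply: AJ.
  (* As [i s 1] is nonzero, [y s] is not in [A]; so [x] is a multiple of [y s] whose coefficient
     kills [i s 1]. *)
  case: (frac_total vR x (y s)) => -[c cE].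
    move: fx; rewrite cE fZ // fy -iZ mulr1 => /i0[k ->].
    by exists k; rewrite embM mulrA.
  case: (i1_neq0 ns); rewrite -fy cE fZ ?fx ?scaler0 //; exact: AJ.
pose z := emb (r s0) * y s0.
have zn : z != 0.
  rewrite mulf_neq0 ?emb_eq0 //; apply/eqP => y0; have [_] := yP s0; rewrite y0 => f0.
  by case: (i1_neq0 ns0); rewrite -f0; apply/fA.
have /choice[c cP] : forall s, exists c, c \is a GRing.unit /\
    (r s \isn't a GRing.unit -> emb (r s) * y s = emb c * z).
  move=> s; case: (boolP (r s \is a GRing.unit)) => [su|ns].
    by exists 1; rewrite unitr1.
  have [c cE] := Agen _ _ ns0 (Ar s); have [c' c'E] := Agen _ _ ns (Ar s0).
  exists c; split=> //; apply/unitrP; exists c'.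
  have cc : c' * c = 1.
    apply: emb_inj; apply: (mulIf zn); rewrite embM -mulrA -cE -c'E /emb tofrac1 mul1r //.
  by split=> //; rewrite mulrC.
case: e_cocycle => _ _ /(_ c); apply; first by move=> s; case: (cP s).
move=> s t st; case: (boolP (r s \is a GRing.unit)) => [su|ns]; first exact: unit_dvd.
have nt : r t \isn't a GRing.unit by apply: contra ns; apply: dvd_unit (r_dvd st).
have [_ /(_ ns) cs] := cP s; have [_ /(_ nt) ct] := cP t.
have [Js fs] := yP s; have [Jt ft] := yP t.
pose d := y s - emb (m s t) * y t.
have Jd : J' d by apply: JB => //; apply: JZ.
have : A d.
  apply/fA => //.
  have E : f (y s) = f d + f (emb (m s t) * y t) by rewrite -fD ?subrK //; apply: JZ.
  have {}E : i s 1 = f d + i s 1.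
    by rewrite -{1}fs E fZ // ft -iZ -(iT _ st).
  by apply: (addIr (i s 1)); rewrite -E add0r.
(* Multiplying [d = k * z] by [r s] and cancelling [z] gives [c s - e t s * c t = k * r s]. *)
move=> /(Agen _ _ ns0)[k kE]; exists k; apply: emb_inj; apply: (mulIf zn).
rewrite embB embM mulrBl -cs -[emb _ * emb (c t) * _]mulrA -ct.
have -> : emb (k * r s) * z = emb (r s) * d by rewrite kE embM [emb k * _]mulrC mulrA.
rewrite /d mulrBr; congr (_ - _); rewrite !mulrA -!embM; congr (emb _ * _).
by rewrite /transition (qP st); ring.
Qed.

End Props.
End TwistedModule.

(** * Non-stationarity of the chain, and the theorem *)

(** If the chain were stationary from [s] on, the topology at every limit above [s] would be
    discrete, hence complete, and the cub of levels above [s] would miss [Gamma_set]. *)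
Lemma Gamma_nonzero_strict (W : Type) (lt : W -> W -> Prop) (R : idomainType) (r : W -> R) :
  is_omega1 lt -> (forall s t, lt s t -> dvd (r s) (r t)) ->
  class_nonzero lt (Gamma_set lt r) -> forall s, exists t, lt s t /\ ~ dvd (r t) (r s).
Proof.
move=> HW r_dvd Gn s; apply: contrapT => nt.
have stab t : dvd (r t) (r s).
  case: (lt_tri HW t s) => [/r_dvd //|->|st]; first by exists 1; rewrite mul1r.
  by apply: contrapT => ns; apply: nt; exists t.
case: (Gn (lt s)) => [|d [[_ nc] sd]].
  split=> [x|d [[x xd] _] dC].
    by have [y [? ?]] := ub2 HW x s; exists y.
  by have [y [sy _ yd]] := dC _ xd; apply: (lt_trans HW) sy yd.
apply: nc => x xC; have [n nP] := xC _ sd; exists (x n) => t td; exists n => k nk.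
exact: dvd_trans (stab t) (nP _ _ nk (leqnn n)).
Qed.

Theorem mainTheorem11 (W : Type) (lt : W -> W -> Prop) :
  is_omega1 lt -> not_CH W ->
  forall (R : idomainType), valuation_domain R -> equipotent R W ->
  forall (J : {fraction R} -> Prop), Qsubmod J -> (forall x : R, J (emb x)) ->
  forall r : W -> R, omega1_chain lt r J ->
  class_nonzero lt (Gamma_set lt r) ->
  exists U : lmodType R, [/\ uniserial U, ~ standard U & has_type U J (@Rpart R)].
Proof.
move=> HW nCH R vR [iota [_ [/can_inj iota_inj _]]] J _ _ r [r_neq0 r_dvd JP] Gn.
have r_strict := Gamma_nonzero_strict HW r_dvd Gn.
have [s0 [e [ns0 ec]]] := cocycle_ex HW nCH vR iota_inj r_dvd r_strict.
(* The quotients [r t / r s], with the default 0 at pairs not in increasing order. *)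
have /choice[q qP] : forall p : W * W, exists c, lt p.1 p.2 -> r p.2 = c * r p.1.
  case=> s t; case: (pselect (lt s t)) => [/r_dvd[c cE]|]; first by exists c.
  by exists 0.
have {}qP s t : lt s t -> r t = q (s, t) * r s by move/(qP (s, t)).
have mC := twisted_comp HW r_neq0 ec qP.
have mI := twisted_inj vR r_neq0 ns0 ec qP.
have [U [i [iD iZ iT i0 iL]]] := direct_limit HW mC mI s0.
exists U; split.
- exact: (@twisted_uniserial _ _ vR _ _ iZ iL).
- exact: (twisted_nonstandard vR r_neq0 r_dvd ns0 ec qP iZ iT i0).
- exact: (twisted_has_type HW vR r_neq0 ns0 ec qP iD iZ iT i0 iL JP).
Qed.
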